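(* Let $f:\mathbb{R}\to\mathbb{C}$ belong to $L^{2,\mathrm{loc}}(\mathbb{R})$ and let $g:\mathbb{R}\to\mathbb{C}$ be a $2\pi$-periodic function belonging to $L^2(\mathbb{T})$. For $k\in\mathbb{Z}$ let $I_k=[2\pi k,2\pi(k+1)]$ and let $\mathbf{1}_{I_k}$ be the characteristic function of $I_k$. Suppose that $$M(f):=\sum_{k\in\mathbb{Z}}\Vert \mathbf{1}_{I_k}f\Vert_2<+\infty .$$ Then $$\int_{\mathbb{R}}f(x)\,\overline{g(x)}\,dx=\sum_{n\in\mathbb{Z}}\widehat{f}(n)\,\overline{C_n(g)},$$ where $\widehat{f}$ is the Fourier transform of $f$ and $(C_n(g))_{n\in\mathbb{Z}}$ is the family of exponential Fourier coefficients of $g$.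
   Context: $L^{2,\mathrm{loc}}(\mathbb{R})$ is the space of locally square integrable functions on $\mathbb{R}$. $L^2(\mathbb{T})$ is the space of $2\pi$-periodic functions that are square integrable over a period. The norm on $L^2(\mathbb{R})$ is $\Vert h\Vert_2=\left(\int_{\mathbb{R}}|h(t)|^2\,dt\right)^{1/2}$. The Fourier transform of an integrable function $f$ on $\mathbb{R}$ is $\widehat{f}(\omega)=\int_{\mathbb{R}}f(t)e^{-i\omega t}\,dt$ for $\omega\in\mathbb{R}$. The exponential Fourier coefficients of a $2\pi$-periodic function $g$ are $C_n(g)=\frac{1}{2\pi}\int_0^{2\pi}g(t)e^{-int}\,dt$ for $n\in\mathbb{Z}$. *)

(* Defs.v *)
From HB Require Import structures.
From mathcomp Require Import all_boot all_order all_algebra.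
From mathcomp Require Import all_classical all_reals all_analysis.
From mathcomp Require Import complex.
From mathcomp Require summability.
Import Order.TTheory GRing.Theory Num.Theory.
Import numFieldTopology.Exports numFieldNormedType.Exports.

Set Implicit Arguments.
Unset Strict Implicit.
Unset Printing Implicit Defensive.

Local Open Scope classical_set_scope.
Local Open Scope ring_scope.
Local Open Scope complex_scope.

Section Definitions.
Context {R : realType}.

(* The measurable space on R is the sigma-algebra of Lebesgue measurable sets,
   on which [completed_lebesgue_measure] lives, and not the Borel one carried
   by [lebesgue_measure]; the carrier of [lebesgueType] is convertible to R. *)
Definition lebesgueType :=
  caratheodory_type (R := R) (mu_ext (wlength idfun)).

Definition leb : {measure set lebesgueType -> \bar R} :=
  completed_lebesgue_measure.

Implicit Types (f g h : R -> R[i]) (D : set R).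

Definition cmeasurable h :=
  measurable_fun (setT : set lebesgueType) (fun x => complex.Re (h x)) /\
  measurable_fun (setT : set lebesgueType) (fun x => complex.Im (h x)).

Definition cintegrable D h :=
  leb.-integrable D (fun x => (complex.Re (h x))%:E) /\
  leb.-integrable D (fun x => (complex.Im (h x))%:E).

(* Meaningful only under [cintegrable D h]. *)
Definition cintegral D h : R[i] :=
  (\int[leb]_(x in D) complex.Re (h x)) +i*
  (\int[leb]_(x in D) complex.Im (h x)).

Definition L2norm h : \bar R :=
  Lnorm leb 2%:E (fun x => (Normc.normc (h x))%:E).

Definition L2loc h := cmeasurable h /\
  forall K : set R, compact K ->
    (\int[leb]_(x in K) ((Normc.normc (h x)) ^+ 2)%:E < +oo)%E.

Definition period : set R := `[0, 2 * pi].

Definition L2torus h := [/\ cmeasurable h,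
  forall x, h (x + 2 * pi) = h x &
  (\int[leb]_(x in period) ((Normc.normc (h x)) ^+ 2)%:E < +oo)%E].

Definition expi (t : R) : R[i] := cos t +i* sin t.

Definition fourier f (w : R) : R[i] :=
  cintegral setT (fun t => f t * expi (- (w * t))).

Definition fourier_coef g (n : int) : R[i] :=
  ((2 * pi)^-1)%:C *
  cintegral period (fun t => g t * expi (- (n%:~R * t))).

Definition Ik (k : int) : set R := `[2 * pi * k%:~R, 2 * pi * (k + 1)%:~R].

Definition amalgam_norm f : \bar R :=
  \esum_(k in [set: int]) L2norm (fun x => (\1_(Ik k) x)%:C * f x).

(* The family [u] is summable with sum [S]: its finite partial sums converge to
   [S] along the net of finite subsets of the index set. *)
Definition has_sum (I : choiceType) (u : I -> R[i]) (S : R[i]) :=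
  summability.partial_sum u A @[A --> summability.totally] --> (S : R[i]^o).

End Definitions.

(* Main.v *)
(** No periodization of [f] is needed.  For a finite set [A] of integers, with
    [S_A g] the partial Fourier sum of [g], the partial sum of the right-hand
    side is the integral of [f * conj (S_A g)].  By Cauchy-Schwarz on each [I_k]
    and translation invariance, it differs from the integral of [f * conj g] by
    at most [2 M(f) ||g - S_A g||], the norm being that of L^2 over a period; by
    orthogonality this is at most [2 M(f) ||g - p||] for every trigonometric
    polynomial [p] with spectrum in [A].  So it suffices that trigonometric
    polynomials are dense in L^2 over a period.

    Density: the measurable sets whose indicator is a limit in L^1 of real
    trigonometric polynomials with values in [0, 1] form a sigma-algebra
    (complements: [1 - q]; intersections: [q * r]) containing the null sets.  It
    contains the rays: if the trigonometric polynomial [y], with values in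
    [0, 1], exceeds 1/2 exactly on the ray, then the iterates of
    [3 y^2 - 2 y^3] converge boundedly to the indicator of the ray.  Simple
    functions then give all of L^2. *)

Require Import Defs.
From mathcomp Require Import all_boot all_order all_algebra.
From mathcomp Require Import finmap.
From mathcomp Require Import all_classical all_reals all_analysis.
From mathcomp Require Import complex ring lra.
From mathcomp Require Import measurable_realfun simple_functions measurable_fun_approximation.
From mathcomp Require summability.
Import Order.TTheory GRing.Theory Num.Theory.
Import numFieldTopology.Exports numFieldNormedType.Exports.

Set Implicit Arguments.
Unset Strict Implicit.
Unset Printing Implicit Defensive.

Local Open Scope classical_set_scope.
Local Open Scope ring_scope.
Local Open Scope complex_scope.

Local Notation normc := Normc.normc.
Local Notation Re := complex.Re.
Local Notation Im := complex.Im.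

(** * Complex-valued integrals and square norms *)

Section ComplexNumbers.
Context {R : rcfType}.
Implicit Types x y z : R[i].

Lemma ReD x y : Re (x + y) = Re x + Re y. Proof. by case: x; case: y. Qed.
Lemma ImD x y : Im (x + y) = Im x + Im y. Proof. by case: x; case: y. Qed.
Lemma ReM x y : Re (x * y) = Re x * Re y - Im x * Im y.
Proof. by case: x; case: y. Qed.
Lemma ImM x y : Im (x * y) = Re x * Im y + Im x * Re y.
Proof. by case: x; case: y. Qed.
Lemma Re_conjc x : Re (conjc x) = Re x. Proof. by case: x. Qed.
Lemma Im_conjc x : Im (conjc x) = - Im x. Proof. by case: x. Qed.

Lemma eq_ReIm x y : Re x = Re y -> Im x = Im y -> x = y.
Proof. by case: x y => a b [c d] /= -> ->. Qed.

Lemma sqr_normc z : normc z ^+ 2 = Re z ^+ 2 + Im z ^+ 2.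
Proof. by case: z => a b /=; rewrite sqr_sqrtr// addr_ge0 ?sqr_ge0. Qed.

Lemma normc_ge0 z : 0 <= normc z.
Proof. by case: z => a b /=; exact: sqrtr_ge0. Qed.

Lemma normc_conj z : normc (conjc z) = normc z.
Proof. by case: z => a b /=; rewrite sqrrN. Qed.

Lemma normcN z : normc (- z) = normc z.
Proof. by case: z => a b /=; rewrite !sqrrN. Qed.

Lemma Re_le_normc z : `|Re z| <= normc z.
Proof. by case: z => a b /=; rewrite -sqrtr_sqr ler_wsqrtr// lerDl sqr_ge0. Qed.

Lemma Im_le_normc z : `|Im z| <= normc z.
Proof. by case: z => a b /=; rewrite -sqrtr_sqr ler_wsqrtr// lerDr sqr_ge0. Qed.

Lemma normc_le z : normc z <= `|Re z| + `|Im z|.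
Proof.
rewrite -ler_sqr ?nnegrE ?normc_ge0 ?addr_ge0// sqr_normc sqrrD !real_normK ?num_real//.
by rewrite lerD2r lerDl mulrn_wge0// mulr_ge0.
Qed.

Lemma sqr_normcD x y :
  normc (x + y) ^+ 2 <= 2 * normc x ^+ 2 + 2 * normc y ^+ 2.
Proof.
rewrite !sqr_normc ReD ImD.
have := sqr_ge0 (Re x - Re y); have := sqr_ge0 (Im x - Im y); nra.
Qed.

Lemma normcC (r : R) : normc r%:C = `|r|.
Proof. by rewrite /= expr0n addr0 sqrtr_sqr. Qed.

End ComplexNumbers.

Section ComplexIntegral.
Context d (T : measurableType d) (R : realType).
Variables (mu : {measure set T -> \bar R}) (D : set T) (mD : measurable D).
Implicit Types u v h : T -> R[i].

Definition cmeas h :=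
  measurable_fun D (fun x => Re (h x)) /\ measurable_fun D (fun x => Im (h x)).

Definition cinteg h := mu.-integrable D (fun x => (Re (h x))%:E) /\
  mu.-integrable D (fun x => (Im (h x))%:E).

Definition cint h : R[i] :=
  (\int[mu]_(x in D) Re (h x)) +i* (\int[mu]_(x in D) Im (h x)).

Definition norm1 h : \bar R := (\int[mu]_(x in D) (normc (h x))%:E)%E.

(** The square of the L^2 norm over [D]. Being extended-real, it is defined before any integrability
    is known, and finiteness is the hypothesis [sqnorm h < +oo]. *)
Definition sqnorm h : \bar R := (\int[mu]_(x in D) ((normc (h x)) ^+ 2)%:E)%E.

Lemma eq_cint u v : (forall x, D x -> u x = v x) -> cint u = cint v.
Proof.
by move=> uv; rewrite /cint; congr (_ +i* _); apply: eq_Rintegral => x /set_mem/uv->.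
Qed.

Lemma cmeas_cst c : cmeas (fun=> c). Proof. by split. Qed.

Lemma cmeasD u v : cmeas u -> cmeas v -> cmeas (fun x => u x + v x).
Proof.
move=> [u1 u2] [v1 v2]; split.
  by under eq_fun do rewrite ReD; exact: measurable_funD.
by under eq_fun do rewrite ImD; exact: measurable_funD.
Qed.

Lemma cmeasM u v : cmeas u -> cmeas v -> cmeas (fun x => u x * v x).
Proof.
move=> [u1 u2] [v1 v2]; split.
  by under eq_fun do rewrite ReM; apply: measurable_funB; exact: measurable_funM.
by under eq_fun do rewrite ImM; apply: measurable_funD; exact: measurable_funM.
Qed.

Lemma cmeas_conj u : cmeas u -> cmeas (fun x => conjc (u x)).
Proof.
move=> [u1 u2]; split; first by under eq_fun do rewrite Re_conjc.
by under eq_fun do rewrite Im_conjc; exact: measurable_funN.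
Qed.

Lemma cmeasN u : cmeas u -> cmeas (fun x => - u x).
Proof.
move=> mu0; rewrite (_ : (fun x => - u x) = (fun x => (-1) * u x)).
  exact: (cmeasM (cmeas_cst _)).
by apply/funext => x; rewrite mulN1r.
Qed.

Lemma cmeasB u v : cmeas u -> cmeas v -> cmeas (fun x => u x - v x).
Proof. by move=> mu0 mv; apply: cmeasD => //; exact: cmeasN. Qed.

Lemma cmeas_sum I (s : seq I) (F : I -> T -> R[i]) :
  (forall i, cmeas (F i)) -> cmeas (fun x => \sum_(i <- s) F i x).
Proof.
move=> mF; elim: s => [|i s IH].
  by under eq_fun do rewrite big_nil; exact: cmeas_cst.
by under eq_fun do rewrite big_cons; exact: cmeasD.
Qed.

Lemma measurable_sqr_normc h :
  cmeas h -> measurable_fun D (fun x => normc (h x) ^+ 2).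
Proof.
move=> [h1 h2]; under eq_fun do rewrite sqr_normc.
by apply: measurable_funD; exact: measurable_funX.
Qed.

Lemma measurable_normc h : cmeas h -> measurable_fun D (fun x => normc (h x)).
Proof.
move=> /measurable_sqr_normc mh.
under eq_fun => x do rewrite -[normc _]ger0_norm ?normc_ge0// -sqrtr_sqr.
apply: (measurableT_comp _ mh); apply: continuous_measurable_fun.
exact: sqrt_continuous.
Qed.

Lemma cinteg_norm1 h : cmeas h -> (norm1 h < +oo)%E -> cinteg h.
Proof.
move=> mh hoo.
have ih : mu.-integrable D (EFin \o (fun x => normc (h x))).
  apply/integrableP; split; first exact/measurable_EFinP/measurable_normc.
  by under eq_integral do rewrite /= ger0_norm ?normc_ge0//.
case: (mh) => m1 m2; split; apply: le_integrable ih => //; try exact/measurable_EFinP.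
  by move=> x _; rewrite /= lee_fin [leRHS]ger0_norm ?normc_ge0// Re_le_normc.
by move=> x _; rewrite /= lee_fin [leRHS]ger0_norm ?normc_ge0// Im_le_normc.
Qed.

(** The real and imaginary parts of the integral are each bounded by [norm1 h], whence the factor 2.
    The constant is harmless, since the bound only serves to show that an error tends to 0. *)
Lemma norm1_cint h : cmeas h -> ((normc (cint h))%:E <= 2%:E * norm1 h)%E.
Proof.
move=> mh.
have [hoo|hoo] := ltP (norm1 h) +oo%E; last first.
  by move: hoo; rewrite leye_eq => /eqP ->; rewrite gt0_muley ?leey// lte_fin.
have [i1 i2] := cinteg_norm1 mh hoo; case: mh => m1 m2.
have H (f : T -> R) : (forall x, `|f x| <= normc (h x)) ->
    mu.-integrable D (EFin \o f) -> measurable_fun D f ->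
    (`|\int[mu]_(x in D) f x|%:E <= norm1 h)%E.
  move=> fh intf mf; rewrite EFin_normr_Rintegral//.
  apply: le_trans (le_abse_integral mu mD _) _; first exact/measurable_EFinP.
  apply: ge0_le_integral => //=.
  - exact/measurable_EFinP/measurableT_comp.
  - exact/measurable_EFinP/measurable_normc.
  - by move=> x _; rewrite lee_fin.
rewrite mule_natl mule2n.
apply: (@le_trans _ _ (`|Re (cint h)|%:E + `|Im (cint h)|%:E)%E).
  by rewrite -EFinD lee_fin normc_le.
by rewrite leeD// /cint/= H// => x; [exact: Re_le_normc|exact: Im_le_normc].
Qed.

Lemma cintegD u v : cinteg u -> cinteg v -> cinteg (fun x => u x + v x).
Proof.
move=> [u1 u2] [v1 v2]; split.
  by under eq_fun do rewrite ReD EFinD; exact: integrableD.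
by under eq_fun do rewrite ImD EFinD; exact: integrableD.
Qed.

Lemma cintD u v : cinteg u -> cinteg v ->
  cint (fun x => u x + v x) = cint u + cint v.
Proof.
move=> [u1 u2] [v1 v2]; rewrite /cint; apply: eq_ReIm; rewrite ?ReD ?ImD /=.
  by under eq_Rintegral do rewrite ReD; exact: RintegralD.
by under eq_Rintegral do rewrite ImD; exact: RintegralD.
Qed.

Lemma cintegZ c u : cinteg u -> cinteg (fun x => c * u x).
Proof.
move=> [u1 u2]; split.
  under eq_fun do rewrite ReM EFinB !EFinM.
  by apply: integrableB => //; exact: integrableZl.
under eq_fun do rewrite ImM EFinD !EFinM.
by apply: integrableD => //; exact: integrableZl.
Qed.

Lemma cintZ c u : cinteg u -> cint (fun x => c * u x) = c * cint u.
Proof.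
move=> [u1 u2]; rewrite /cint; apply: eq_ReIm; rewrite ?ReM ?ImM /=.
  under eq_Rintegral do rewrite ReM.
  rewrite RintegralB//; last 2 first.
  - by rewrite /comp; under eq_fun do rewrite EFinM; exact: integrableZl.
  - by rewrite /comp; under eq_fun do rewrite EFinM; exact: integrableZl.
  by rewrite !RintegralZl.
under eq_Rintegral do rewrite ImM.
rewrite RintegralD//; last 2 first.
- by rewrite /comp; under eq_fun do rewrite EFinM; exact: integrableZl.
- by rewrite /comp; under eq_fun do rewrite EFinM; exact: integrableZl.
by rewrite !RintegralZl.
Qed.

Lemma cintB u v : cinteg u -> cinteg v ->
  cint (fun x => u x - v x) = cint u - cint v.
Proof.
move=> iu iv; under eq_fun do rewrite -mulN1r.
by rewrite cintD ?cintZ ?mulN1r//; exact: cintegZ.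
Qed.

Lemma cint_conj u : cinteg u -> cint (fun x => conjc (u x)) = conjc (cint u).
Proof.
move=> [u1 u2]; apply: eq_ReIm; rewrite ?Re_conjc ?Im_conjc /cint /=.
  by under eq_Rintegral do rewrite Re_conjc.
by under eq_Rintegral do rewrite Im_conjc -mulN1r; rewrite RintegralZl// mulN1r.
Qed.

Lemma cinteg_sum I (s : seq I) (F : I -> T -> R[i]) :
  (forall i, cinteg (F i)) -> cinteg (fun x => \sum_(i <- s) F i x).
Proof.
move=> iF; elim: s => [|i s IH].
  by under eq_fun do rewrite big_nil; split; exact: integrable0.
by under eq_fun do rewrite big_cons; exact: cintegD.
Qed.

Lemma cint_sum I (s : seq I) (F : I -> T -> R[i]) :
  (forall i, cinteg (F i)) ->
  cint (fun x => \sum_(i <- s) F i x) = \sum_(i <- s) cint (F i).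
Proof.
move=> iF; elim: s => [|i s IH].
  rewrite big_nil; under eq_cint do rewrite big_nil.
  by rewrite /cint /Rintegral integral0.
rewrite big_cons; under eq_cint do rewrite big_cons.
by rewrite cintD ?IH//; exact: cinteg_sum.
Qed.

Lemma sqnorm_ge0 h : (0 <= sqnorm h)%E.
Proof. by apply: integral_ge0 => x _; rewrite lee_fin sqr_ge0. Qed.

(** Integrates the pointwise inequality that follows from the parallelogram law. It plays the part
    of the triangle inequality for squared norms. *)
Lemma sqnormD u v : cmeas u -> cmeas v ->
  (sqnorm (fun x => u x + v x)%R <= 2%:E * sqnorm u + 2%:E * sqnorm v)%E.
Proof.
move=> mu0 mv.
have mu2 := measurable_sqr_normc mu0; have mv2 := measurable_sqr_normc mv.
rewrite -!ge0_integralZl ?lee_fin//; try by move=> *; rewrite lee_fin sqr_ge0.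
2,3: exact/measurable_EFinP.
rewrite -ge0_integralD//; try by move=> *; rewrite mule_ge0// lee_fin sqr_ge0.
2,3: by under eq_fun do rewrite -EFinM; exact/measurable_EFinP/measurable_funM.
apply: ge0_le_integral => //.
- by move=> *; rewrite lee_fin sqr_ge0.
- exact/measurable_EFinP/measurable_sqr_normc/cmeasD.
- by under eq_fun do rewrite -!EFinM -EFinD; apply/measurable_EFinP/measurable_funD;
    exact: measurable_funM.
- by move=> x _; rewrite -!EFinM -EFinD lee_fin sqr_normcD.
Qed.

Lemma sqnormD_lty u v : cmeas u -> cmeas v ->
  (sqnorm u < +oo -> sqnorm v < +oo -> sqnorm (fun x => u x + v x)%R < +oo)%E.
Proof.
move=> mu0 mv uoo voo; apply: le_lt_trans (sqnormD mu0 mv) _.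
by rewrite lte_add_pinfty// lte_mul_pinfty// lee_fin.
Qed.

Lemma sqnormZ c u : cmeas u ->
  sqnorm (fun x => c * u x) = ((normc c ^+ 2)%:E * sqnorm u)%E.
Proof.
move=> mu0; rewrite -ge0_integralZl ?lee_fin ?sqr_ge0//.
- by apply: eq_integral => x _; rewrite Normc.normcM exprMn EFinM.
- exact/measurable_EFinP/measurable_sqr_normc.
- by move=> *; rewrite lee_fin sqr_ge0.
Qed.

Lemma sqnormZ_lty c u : cmeas u ->
  (sqnorm u < +oo -> sqnorm (fun x => c * u x)%R < +oo)%E.
Proof. by move=> mu0 uoo; rewrite sqnormZ// lte_mul_pinfty// lee_fin sqr_ge0. Qed.

Lemma sqnorm_conj u : sqnorm (fun x => conjc (u x)) = sqnorm u.
Proof. by apply: eq_integral => x _; rewrite normc_conj. Qed.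

Lemma sqnormB_lty u v : cmeas u -> cmeas v ->
  (sqnorm u < +oo -> sqnorm v < +oo -> sqnorm (fun x => u x - v x)%R < +oo)%E.
Proof.
move=> mu0 mv uoo voo; apply: sqnormD_lty => //; first exact: cmeasN.
by rewrite /sqnorm; under eq_integral do rewrite normcN.
Qed.

(** Pointwise, |u v| is at most |u|^2 + |v|^2, because the square of |u| - |v| is nonnegative. *)
Lemma cinteg_mul_conj u v : cmeas u -> cmeas v ->
  (sqnorm u < +oo)%E -> (sqnorm v < +oo)%E -> cinteg (fun x => u x * conjc (v x)).
Proof.
move=> mu0 mv uoo voo; apply: cinteg_norm1; first exact/cmeasM/cmeas_conj.
apply: (@le_lt_trans _ _ (sqnorm u + sqnorm v)%E); last exact: lte_add_pinfty.
rewrite -ge0_integralD//; try by move=> *; rewrite lee_fin sqr_ge0.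
2,3: exact/measurable_EFinP/measurable_sqr_normc.
apply: ge0_le_integral => //.
- by move=> *; rewrite lee_fin normc_ge0.
- exact/measurable_EFinP/measurable_normc/cmeasM/cmeas_conj.
- by under eq_fun do rewrite -EFinD; apply/measurable_EFinP/measurable_funD;
    exact: measurable_sqr_normc.
- move=> x _; rewrite -EFinD lee_fin Normc.normcM normc_conj.
  by have := sqr_ge0 (normc (u x) - normc (v x)); nra.
Qed.

Lemma sqnormE u : cmeas u -> (sqnorm u < +oo)%E ->
  sqnorm u = (Re (cint (fun x => u x * conjc (u x))))%:E.
Proof.
move=> mu0 uoo; rewrite /cint/= /Rintegral fineK.
  by apply: eq_integral => x _; rewrite ReM Re_conjc Im_conjc sqr_normc mulrN opprK !expr2.
have [i1 _] := cinteg_mul_conj mu0 mu0 uoo uoo.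
exact: (integrable_fin_num mD i1).
Qed.

(** Pythagoras: expanding the square of the sum leaves two cross terms. One vanishes by hypothesis,
    the other is its conjugate; the squared norm of [v] is then dropped. *)
Lemma sqnorm_le_orthogonal u v : cmeas u -> cmeas v ->
  (sqnorm u < +oo)%E -> (sqnorm v < +oo)%E ->
  cint (fun x => u x * conjc (v x)) = 0 ->
  (sqnorm u <= sqnorm (fun x => u x + v x)%R)%E.
Proof.
move=> mu0 mv uoo voo uv0.
have i1 := cinteg_mul_conj mu0 mu0 uoo uoo.
have i2 := cinteg_mul_conj mu0 mv uoo voo.
have i3 := cinteg_mul_conj mv mu0 voo uoo.
have i4 := cinteg_mul_conj mv mv voo voo.
rewrite [leRHS]sqnormE; [|exact: cmeasD|exact: sqnormD_lty].
rewrite (@eq_cint _ (fun x => (u x * conjc (u x) + u x * conjc (v x)) +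
    (v x * conjc (u x) + v x * conjc (v x)))); last first.
  by move=> x _; rewrite rmorphD/= mulrDl !mulrDr.
rewrite cintD; [|exact: cintegD..]; rewrite cintD// cintD// uv0 addr0.
have -> : cint (fun x => v x * conjc (u x)) = 0.
  rewrite -[RHS]conjc0 -uv0 -cint_conj//; apply: eq_cint => x _.
  by rewrite rmorphM/= conjcK mulrC.
by rewrite add0r ReD EFinD -!sqnormE// leeDl// sqnorm_ge0.
Qed.

End ComplexIntegral.

(** * Lebesgue measure on the Caratheodory sigma-algebra *)

Definition pushforward_measure d d' (T1 : measurableType d)
    (T2 : measurableType d') (R : realType) (m : {measure set T1 -> \bar R})
    (f : T1 -> T2) (mf : measurable_fun setT f) : {measure set T2 -> \bar R} :=
  measure_function_pushforward__canonical__measure_function_Measure m mf.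

Section LebesgueMeasurableSets.
Context {R : realType}.
Notation T := (@lebesgueType R).
Notation mu := (@leb R).

Lemma borel_lebesgue_measurable (A : set (measurableTypeR R)) :
  measurable A -> measurable (A : set T).
Proof. exact: sub_caratheodory. Qed.

(** Both are the same outer measure as functions of sets; only the sigma-algebras differ. *)
Lemma lebE (A : set R) : mu A = lebesgue_measure A.
Proof. by []. Qed.

Lemma measurable_id_lebesgue :
  measurable_fun setT (id : T -> measurableTypeR R).
Proof. by move=> _ B mB; rewrite setTI; exact: borel_lebesgue_measurable. Qed.

Lemma measurable_itv_lebesgue (i : interval R) : measurable ([set` i] : set T).
Proof. by apply: borel_lebesgue_measurable; exact: measurable_itv. Qed.

Lemma measurable_fun_lebesgue (f : R -> R) (D : set T) :
  continuous f -> measurable D -> measurable_fun D (f : T -> R).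
Proof.
move=> cf mD; apply: (@measurable_funS _ _ _ _ setT) => //.
apply: (@measurableT_comp _ _ _ _ (measurableTypeR R) _ f).
  exact: continuous_measurable_fun.
exact: measurable_id_lebesgue.
Qed.

Lemma leb_itv (i : interval R) :
  mu [set` i] = (if (i.1 < i.2)%E then (i.2 : \bar R) - i.1 else 0)%E.
Proof. by rewrite lebE lebesgue_measure_itv. Qed.

(** The identity, from Lebesgue to Borel measurable sets, pushes [leb] forward to
    [lebesgue_measure]. This gives access to the fundamental theorem of calculus, which concerns the
    Borel structure. *)
Lemma integral_leb_continuous (f : R -> R) (a b : R) : continuous f ->
  (\int[mu]_(x in `[a, b]) (f x)%:E =
   \int[lebesgue_measure]_(x in `[a, b]) (f x)%:E)%E.
Proof.
move=> cf.
rewrite -(@integral_pushforward _ _ _ _ _ _ measurable_id_lebesgue mu `[a, b] (EFin \o f)).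
- exact: (@eq_measure_integral _ _ R _ (@lebesgue_measure R)
    (pushforward_measure mu measurable_id_lebesgue)).
- exact: (measurableT_comp (@EFin_measurable R setT) (continuous_measurable_fun cf)).
- apply/integrableP; split.
    by apply/measurable_EFinP/measurable_fun_lebesgue => //; exact: measurable_itv_lebesgue.
  (* The change of variables for a signed function asks for integrability, which holds as [f] is
     bounded on the compact interval. *)
  have [M M0 fM] : exists2 M : R, 0 <= M & forall x, x \in `[a, b] -> `|f x| <= M.
    have := compact_bounded (continuous_compact (continuous_subspaceT cf)
      (@segment_compact _ a b)).
    move=> [M [_ HM]]; exists (`|M| + 1); first by rewrite addr_ge0.
    move=> x xab; apply: (HM (`|M| + 1)); first by rewrite ltr_pwDr ?ler_norm.
    by exists x.
  apply: (@le_lt_trans _ _ (\int[mu]_(x in `[a, b]) (cst M%:E x))%E).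
    apply: ge0_le_integral => //=.
    - exact: measurable_itv_lebesgue.
    - apply/measurable_EFinP/measurableT_comp => //.
      by apply: measurable_fun_lebesgue => //; exact: measurable_itv_lebesgue.
  rewrite integral_cst//; last exact: measurable_itv_lebesgue.
  by rewrite leb_itv/=; case: ifP => _; rewrite ?mule0 ?ltry// -EFinB -EFinM ltry.
- exact: measurable_itv.
Qed.

(** A cover of [X] by half-open intervals translates to a cover of the translated set with the same
    total length. Applying this to [a] and to [- a] gives equality. *)
Lemma mu_ext_shift (a : R) (X : set R) :
  (mu_ext (@wlength R idfun) ((fun x => x + a)%R @^-1` X) <=
   mu_ext (@wlength R idfun) X)%E.
Proof.
apply: le_ereal_inf_tmp => _ [A [mA XA] <-].
have mA' k : ocitv ((fun x => (x + a)%R) @^-1` A k) /\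
    wlength idfun ((fun x => (x + a)%R) @^-1` A k) = wlength idfun (A k).
  have /ocitvP[->|[[u v]/= uv ->]] := mA k.
    by rewrite preimage_set0; split => //; exact: ocitv0.
  have -> : (fun x => (x + a)%R) @^-1` `]u, v]%classic = `]u - a, v - a]%classic.
    by apply/seteqP; split => x /=; rewrite !in_itv/= ltrBlDr lerBrDr.
  split; first exact: is_ocitv.
  by rewrite !wlength_itv_bnd ?lerD2r ?ltW//=; congr (_%:E); ring.
apply: ereal_inf_lbound; exists (fun k => (fun x => (x + a)%R) @^-1` A k).
  split=> [k|x /XA[k _ Ak]]; first exact: (mA' k).1.
  by exists k.
by apply: eq_eseriesr => k _; exact: (mA' k).2.
Qed.

Lemma mu_ext_shiftE (a : R) (X : set R) :
  mu_ext (@wlength R idfun) ((fun x => x + a)%R @^-1` X) =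
  mu_ext (@wlength R idfun) X.
Proof.
apply/eqP; rewrite eq_le mu_ext_shift/=.
rewrite [leLHS](_ : _ = mu_ext (@wlength R idfun)
  ((fun x => x - a) @^-1` ((fun x => x + a) @^-1` X))).
  exact: mu_ext_shift.
by congr mu_ext; apply/seteqP; split => x /=; rewrite subrK.
Qed.

(** Measurability is the Caratheodory splitting condition. To split [X] along the translate of [B],
    translate [X] instead, split along [B], and translate back by invariance of the outer
    measure. *)
Lemma measurable_shift_lebesgue (a : R) :
  measurable_fun setT ((fun x => x + a) : T -> T).
Proof.
move=> _ B mB; rewrite setTI.
pose nu := mu_ext (@wlength R idfun).
have mBX (X : set R) : (nu X = nu (X `&` B) + nu (X `&` ~` B))%E := mB X.
pose C : set R := (fun x => x + a) @^-1` B.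
suff H (X : set R) : (nu X = nu (X `&` C) + nu (X `&` ~` C))%E by exact: H.
have := mBX ((fun x => x - a) @^-1` X).
rewrite /nu mu_ext_shiftE => ->.
by congr (_ + _)%E; rewrite -(mu_ext_shiftE a); congr mu_ext;
  apply/seteqP; split => x /=; rewrite addrK.
Qed.

Lemma ge0_integral_leb_shift (a : R) (D : set T) (f : T -> \bar R) :
  measurable D -> measurable_fun D f -> (forall x, 0 <= f x)%E ->
  (\int[mu]_(x in D) f x =
   \int[mu]_(x in (fun x : T => (x + a)%R : T) @^-1` D) f (x + a)%R)%E.
Proof.
move=> mD mf f0; have mphi := measurable_shift_lebesgue a.
transitivity (\int[pushforward mu ((fun x => x + a)%R : T -> T)]_(x in D) f x)%E.
  apply: (@eq_measure_integral _ _ R _ (pushforward_measure mu mphi) mu) => A mA _.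
  by apply/esym; exact: mu_ext_shiftE.
by rewrite ge0_integral_pushforward.
Qed.

End LebesgueMeasurableSets.

(** * Exponentials and their orthogonality *)

Section Exponentials.
Context {R : realType}.
Implicit Types (n m : int) (t : R).

Definition cexp n t : R[i] := expi (n%:~R * t).

Lemma expiD (x y : R) : expi (x + y) = expi x * expi y.
Proof. by apply: eq_ReIm; rewrite ?ReM ?ImM /= ?cosD ?sinD // [RHS]addrC. Qed.

Lemma expi0 : expi (0 : R) = 1.
Proof. by rewrite /expi cos0 sin0. Qed.

Lemma conjc_expi (x : R) : conjc (expi x) = expi (- x).
Proof. by rewrite /expi /= cosN sinN. Qed.

Lemma normc_expi (x : R) : normc (expi x) = 1.
Proof. by rewrite /= cos2Dsin2 sqrtr1. Qed.

Lemma cexpM n m t : cexp n t * cexp m t = cexp (n + m) t.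
Proof. by rewrite /cexp -expiD -mulrDl -intrD. Qed.

Lemma conjc_cexp n t : conjc (cexp n t) = cexp (- n) t.
Proof. by rewrite /cexp conjc_expi mulrNz mulNr. Qed.

Lemma cexp0 t : cexp 0 t = 1.
Proof. by rewrite /cexp mul0r expi0. Qed.

Lemma cexp_pi n : cexp n (2 * pi) = 1 :> R[i].
Proof.
have H (k : nat) : cexp k%:Z (2 * pi) = 1 :> R[i].
  elim: k => [|k IH]; first exact: cexp0.
  rewrite -addn1 PoszD -cexpM IH mul1r /cexp mul1r /expi.
  by rewrite mulr_natl cos2pi sin2pi.
case: n => [k|k]; first exact: H.
by rewrite NegzE -conjc_cexp H conjc1.
Qed.

Lemma cexp_periodic n t : cexp n (t + 2 * pi) = cexp n t.
Proof. by rewrite /cexp mulrDr expiD [expi (_ * (_ * _))]cexp_pi mulr1. Qed.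

Lemma periodic_int (V : Type) (h : R -> V) : (forall x, h (x + 2 * pi) = h x) ->
  forall (k : int) x, h (x + 2 * pi * k%:~R) = h x.
Proof.
move=> hper; have H (k : nat) x : h (x + 2 * pi * k%:R) = h x.
  elim: k x => [|k IH] x; first by rewrite mulr0 addr0.
  by rewrite -[k.+1%:R]natr1 mulrDr mulr1 addrA hper IH.
case=> [k|k] x; first exact: H.
rewrite NegzE mulrNz mulrN -(H k.+1 (x - _)) subrK //.
Qed.

Lemma continuous_cos_int n : continuous (fun t => cos (n%:~R * t)).
Proof.
move=> t; apply: continuous_comp; first exact: mulrl_continuous.
exact: continuous_cos.
Qed.

Lemma continuous_sin_int n : continuous (fun t => sin (n%:~R * t)).
Proof.
move=> t; apply: continuous_comp; first exact: mulrl_continuous.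
exact: continuous_sin.
Qed.

Lemma cmeas_cexp n (D : set lebesgueType) : measurable D ->
  cmeas D (cexp n : lebesgueType -> R[i]).
Proof.
move=> mD; split; apply: measurable_fun_lebesgue => //.
  exact: continuous_cos_int.
exact: continuous_sin_int.
Qed.

Lemma integral_leb_FTC (f F : R -> R) (a b : R) : a < b -> continuous f ->
  (forall x : R, is_derive x 1 F (f x)) ->
  (\int[leb]_(x in `[a, b]) (f x)%:E = (F b)%:E - (F a)%:E)%E.
Proof.
move=> ab cf dF; rewrite integral_leb_continuous//.
have cF : continuous F.
  by move=> x; apply/differentiable_continuous/derivable1_diffP; exact: ex_derive.
apply: continuous_FTC2 => //.
- exact: continuous_subspaceT.
- split=> [x _||]; first exact: ex_derive.
    by apply: cvg_at_right_filter; exact: cF.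
  by apply: cvg_at_left_filter; exact: cF.
- by move=> x _; rewrite derive1E derive_val.
Qed.

Lemma pi2_gt0 : 0 < 2 * pi :> R.
Proof. by rewrite mulr_gt0// pi_gt0. Qed.

Lemma measurable_period : measurable (@period R : set lebesgueType).
Proof. exact: measurable_itv_lebesgue. Qed.

Lemma leb_period : @leb R period = (2 * pi)%:E.
Proof. by rewrite leb_itv /= lte_fin pi2_gt0 oppr0 adde0. Qed.

Lemma cint_cexp n :
  cint leb (@period R) (cexp n) = ((n == 0)%:R * (2 * pi))%:C.
Proof.
have [->|n0] := eqVneq n 0.
  under eq_cint do rewrite cexp0.
  rewrite mul1r /cint /= !Rintegral_cst ?mul0r//; try exact: measurable_period.
  by rewrite mul1r leb_period.
have nR0 : n%:~R != 0 :> R by rewrite intr_eq0.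
have [/= c1 s1] : cos (n%:~R * (2 * pi)) = 1 :> R /\ sin (n%:~R * (2 * pi)) = 0 :> R.
  by have [-> ->] := cexp_pi n.
(* For nonzero [n] these primitives are periodic, so they take equal values at the two ends of the
   period and both integrals vanish. *)
have dS (x : R) : is_derive x 1 (fun t => (n%:~R)^-1 * sin (n%:~R * t)) (cos (n%:~R * x)).
  by apply: is_derive_eq; rewrite /= /GRing.scale /=; field.
have dC (x : R) : is_derive x 1 (fun t => - (n%:~R)^-1 * cos (n%:~R * t)) (sin (n%:~R * x)).
  by apply: is_derive_eq; rewrite /= /GRing.scale /=; field.
have Ic := integral_leb_FTC pi2_gt0 (@continuous_cos_int n) dS.
have Is := integral_leb_FTC pi2_gt0 (@continuous_sin_int n) dC.
rewrite s1 !mulr0 sin0 mulr0 subee// in Ic.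
rewrite c1 mulr0 cos0 mulr1 subee// in Is.
by rewrite mul0r /cint /cexp /expi /= /Rintegral Ic Is.
Qed.

End Exponentials.

(** * Trigonometric polynomials and Bessel's inequality *)

Section TrigonometricPolynomials.
Context {R : realType}.
Implicit Types (n m : int) (g h p q : R -> R[i]).
Notation mu := (@leb R).
Notation P := (@period R).
Notation sqn := (sqnorm mu P).

Let mP : measurable (P : set lebesgueType) := @measurable_period R.

Definition l2 h := cmeas (P : set lebesgueType) h /\ (sqn h < +oo)%E.

(** Generated inductively, so that closure under products and square integrability follow by
    induction, with no coefficients to track. The frequencies are recovered in [trig_spectrum]. *)
Inductive trig : (R -> R[i]) -> Prop :=
| trig_monomial c n : trig (fun t => c * cexp n t)
| trig_add p q : trig p -> trig q -> trig (fun t => p t + q t).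

Lemma trig_mul p q : trig p -> trig q -> trig (fun t => p t * q t).
Proof.
move=> tp tq; elim: tp => [c n|p1 p2 _ t1 _ t2]; last first.
  by under eq_fun do rewrite mulrDl; exact: trig_add.
elim: tq => [c' m|p1 p2 _ t1 _ t2]; last first.
  by under eq_fun do rewrite mulrDr; exact: trig_add.
by under eq_fun do rewrite mulrACA cexpM; exact: trig_monomial.
Qed.

Lemma trig_cst c : trig (fun=> c).
Proof.
rewrite (_ : (fun=> c) = (fun t => c * cexp 0 t)); first exact: trig_monomial.
by apply/funext => t; rewrite cexp0 mulr1.
Qed.

Lemma l2_bounded h (M : R) : cmeas (P : set lebesgueType) h ->
  (forall t, normc (h t) <= M) -> l2 h.
Proof.
move=> mh hM; split=> //.
apply: (@le_lt_trans _ _ (\int[mu]_(x in P) (cst (M ^+ 2)%:E x))%E).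
  apply: ge0_le_integral.
  - exact: mP.
  - by move=> x _; rewrite lee_fin sqr_ge0.
  - exact/measurable_EFinP/measurable_sqr_normc.
  - exact: measurable_cst.
  - move=> x _; rewrite lee_fin ler_sqr ?nnegrE ?normc_ge0//.
    by rewrite (le_trans _ (hM x))// normc_ge0.
by rewrite integral_cst// leb_period -EFinM ltry.
Qed.

Lemma l2D g h : l2 g -> l2 h -> l2 (fun t => g t + h t).
Proof. by move=> [mg goo] [mh hoo]; split; [exact: cmeasD|exact: sqnormD_lty]. Qed.

Lemma l2B g h : l2 g -> l2 h -> l2 (fun t => g t - h t).
Proof. by move=> [mg goo] [mh hoo]; split; [exact: cmeasB|exact: sqnormB_lty]. Qed.

Lemma l2Z c h : l2 h -> l2 (fun t => c * h t).
Proof.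
move=> [mh hoo]; split; last exact: sqnormZ_lty.
by apply: cmeasM => //; exact: cmeas_cst.
Qed.

Lemma l2_cexp n : l2 (cexp n).
Proof.
apply: (@l2_bounded _ 1); first exact: cmeas_cexp.
by move=> t; rewrite normc_expi.
Qed.

Lemma l2_trig p : trig p -> l2 p.
Proof.
by elim=> [c n|p1 p2 _ h1 _ h2]; [exact/l2Z/l2_cexp|exact: l2D].
Qed.

Lemma l2_integ g h : l2 g -> l2 h -> cinteg mu P (fun t => g t * conjc (h t)).
Proof. by move=> [mg goo] [mh hoo]; exact: cinteg_mul_conj. Qed.

Lemma fourier_coefE h n : fourier_coef h n =
  ((2 * pi)^-1)%:C * cint mu P (fun t => h t * conjc (cexp n t)).
Proof.
by congr (_ * _); apply: eq_cint => x _; rewrite conjc_expi.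
Qed.

Lemma fourier_coefB g h n : l2 g -> l2 h ->
  fourier_coef (fun t => g t - h t) n = fourier_coef g n - fourier_coef h n.
Proof.
move=> lg lh; rewrite !fourier_coefE -mulrBr -(cintB mP (l2_integ lg (l2_cexp n))
  (l2_integ lh (l2_cexp n))).
by congr (_ * _); apply: eq_cint => x _; rewrite mulrBl.
Qed.

Lemma fourier_coefD g h n : l2 g -> l2 h ->
  fourier_coef (fun t => g t + h t) n = fourier_coef g n + fourier_coef h n.
Proof.
move=> lg lh; rewrite !fourier_coefE -mulrDr -(cintD mP (l2_integ lg (l2_cexp n))
  (l2_integ lh (l2_cexp n))).
by congr (_ * _); apply: eq_cint => x _; rewrite mulrDl.
Qed.

Lemma cint_cexp_conj n m :
  cint mu P (fun t => cexp n t * conjc (cexp m t)) = ((n == m)%:R * (2 * pi))%:C.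
Proof.
rewrite -subr_eq0 -cint_cexp; apply: eq_cint => x _.
by rewrite conjc_cexp cexpM.
Qed.

Lemma fourier_coef_monomial (c : R[i]) n m :
  fourier_coef (fun t => c * cexp n t) m = c *+ (n == m).
Proof.
have pi2 : 2 * pi != 0 :> R by rewrite gt_eqF// pi2_gt0.
rewrite fourier_coefE; under eq_cint do rewrite -mulrA.
rewrite (cintZ mP _ (l2_integ (l2_cexp n) (l2_cexp m))).
rewrite cint_cexp_conj mulrCA -rmorphM/=.
case: eqP => _; first by rewrite mul1r mulVf// rmorph1 mulr1.
by rewrite mul0r mulr0 rmorph0 mulr0.
Qed.

Definition fourier_partial (s : seq int) h t : R[i] :=
  \sum_(n <- s) fourier_coef h n * cexp n t.

Lemma conjc_fourier_partial s h t : conjc (fourier_partial s h t) =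
  \sum_(n <- s) conjc (fourier_coef h n) * conjc (cexp n t).
Proof.
rewrite /fourier_partial (rmorph_sum (@conjc R)); apply: eq_bigr => n _.
by rewrite (rmorphM (@conjc R)).
Qed.

Lemma l2_fourier_partial s h : l2 (fourier_partial s h).
Proof.
rewrite /fourier_partial; elim: s => [|n s IH].
  by under eq_fun do rewrite big_nil; exact/l2_trig/trig_cst.
under eq_fun do rewrite big_cons.
exact: (l2D (l2Z _ (l2_cexp n)) IH).
Qed.

(** By orthogonality only the frequency [n] of the partial sum contributes, and it does so once
    because [s] has no repetition. Its factor 2 pi cancels the normalisation of the coefficient. *)
Lemma fourier_remainder_orthogonal s h n : uniq s -> n \in s -> l2 h ->
  cint mu P (fun t => (h t - fourier_partial s h t) * conjc (cexp n t)) = 0.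
Proof.
move=> us ns lh; under eq_cint do rewrite mulrBl mulr_suml.
have le := l2_cexp n; have lS := l2_fourier_partial s h.
have im m : cinteg mu P (fun t => fourier_coef h m * cexp m t * conjc (cexp n t)).
  exact: (l2_integ (l2Z _ (l2_cexp m)) le).
rewrite (cintB mP (l2_integ lh le) (cinteg_sum mP s im)).
rewrite (cint_sum mP s im).
rewrite (bigD1_seq n)//= big1 ?addr0; last first.
  move=> m mn; under eq_cint do rewrite -mulrA.
  rewrite (cintZ mP _ (l2_integ (l2_cexp m) le)).
  by rewrite cint_cexp_conj (negbTE mn) mul0r mulr0.
under [X in _ - X]eq_cint do rewrite -mulrA.
rewrite (cintZ mP _ (l2_integ le le)).
rewrite cint_cexp_conj eqxx mul1r fourier_coefE mulrAC -rmorphM/=.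
by rewrite mulVf ?gt_eqF ?pi2_gt0// mul1r subrr.
Qed.

(** [h] is the sum of the remainder and of the partial sum, which are orthogonal, so Pythagoras
    applies. *)
Lemma bessel s h : uniq s -> l2 h ->
  (sqn (fun t => h t - fourier_partial s h t)%R <= sqn h)%E.
Proof.
move=> us lh; have lS := l2_fourier_partial s h.
have lr := l2B lh lS; case: (lS) (lr) => [mS Soo] [mr roo].
rewrite [leRHS](_ : _ = sqn (fun t =>
    (h t - fourier_partial s h t) + fourier_partial s h t)); last first.
  by congr sqnorm; apply/funext => t; rewrite subrK.
apply: (sqnorm_le_orthogonal mP mr mS roo Soo).
rewrite (@eq_cint _ _ _ _ _ _ (fun t : lebesgueType =>
    \sum_(n <- s) (conjc (fourier_coef h n) * ((h t - fourier_partial s h t) * conjc (cexp n t))))); last first.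
  by move=> t _; rewrite conjc_fourier_partial mulr_sumr; apply: eq_bigr => n _;
    rewrite mulrCA.
rewrite (cint_sum mP) => [|n]; last exact: (cintegZ mP _ (l2_integ lr (l2_cexp n))).
rewrite big_seq big1// => n ns; rewrite (cintZ mP _ (l2_integ lr (l2_cexp n))).
by rewrite fourier_remainder_orthogonal// mulr0.
Qed.

(** Coefficients outside the spectrum vanish, so enlarging [s] changes nothing. The quantification
    over all larger [s] is what lets the induction join two spectra, and it matches convergence
    along finite sets. *)
Lemma trig_spectrum p : trig p -> exists A : seq int, forall s, uniq s ->
  {subset A <= s} -> fourier_partial s p = p.
Proof.
elim=> [c n|p1 p2 t1 [A1 H1] t2 [A2 H2]].
  exists [:: n] => s us /(_ n); rewrite mem_head => /(_ isT) ns.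
  apply/funext => t; rewrite /fourier_partial (bigD1_seq n)//=.
  rewrite fourier_coef_monomial eqxx big1 ?addr0// => m mn.
  by rewrite fourier_coef_monomial eq_sym (negbTE mn) mul0r.
exists (A1 ++ A2) => s us As; apply/funext => t.
rewrite -[in RHS](H1 s)// -1?[in RHS](H2 s)//; last 2 first.
- by move=> n nA; apply: As; rewrite mem_cat nA orbT.
- by move=> n nA; apply: As; rewrite mem_cat nA.
rewrite /fourier_partial -big_split/=; apply: eq_bigr => n _.
by rewrite (fourier_coefD n (l2_trig t1) (l2_trig t2)) mulrDl.
Qed.

(** As [p] is its own partial sum, the remainder of [g] equals the remainder of [g - p], to which
    Bessel's inequality applies. *)
Lemma fourier_partial_best_approx g p (A : seq int) : l2 g -> trig p ->
  (forall s, uniq s -> {subset A <= s} -> fourier_partial s p = p) ->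
  forall s, uniq s -> {subset A <= s} ->
  (sqn (fun t => g t - fourier_partial s g t)%R <= sqn (fun t => g t - p t)%R)%E.
Proof.
move=> lg tp HA s us As; have lp := l2_trig tp.
apply: le_trans (bessel us (l2B lg lp)).
rewrite le_eqVlt; apply/orP; left; apply/eqP; congr sqnorm; apply/funext => t.
have -> : fourier_partial s (fun t => g t - p t) t =
    fourier_partial s g t - fourier_partial s p t.
  rewrite /fourier_partial -sumrB; apply: eq_bigr => n _.
  by rewrite (fourier_coefB n lg lp) mulrBl.
by rewrite HA// opprB addrA subrK.
Qed.

End TrigonometricPolynomials.

(** * Approximation of indicators *)

Lemma measurable_EFin_dist d (T : measurableType d) (R : realType) (D : set T)
    (f g : T -> R) : measurable_fun D f -> measurable_fun D g ->
  measurable_fun D (fun t => `|f t - g t|%:E).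
Proof.
by move=> mf mg; apply/measurable_EFinP/measurableT_comp => //; exact: measurable_funB.
Qed.

Section IndicatorApproximation.
Context d (T : measurableType d) (R : realType).
Variables (mu : {measure set T -> \bar R}) (D : set T).
Hypotheses (mD : measurable D) (muD : (mu D < +oo)%E).
Variable Q : set (T -> R).
Hypothesis Qmeas : forall q, Q q -> measurable_fun D q.
Hypothesis Q01 : forall q t, Q q -> 0 <= q t <= 1.
Hypothesis Q0 : Q (fun=> 0).
Hypothesis QC : forall q, Q q -> Q (fun t => 1 - q t).
Hypothesis QM : forall q r, Q q -> Q r -> Q (fun t => q t * r t).

(** Approximation is in L^1 over [D], by an abstract class [Q] of functions with values in [0, 1];
    [Q] is later the class [rtrig01]. *)
Definition indic_approx (E : set T) := forall e : R, 0 < e ->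
  exists2 q, Q q & (\int[mu]_(t in D) `|\1_E t - q t|%:E <= e%:E)%E.

Let mind (E : set T) : measurable E -> measurable_fun D (\1_E : T -> R).
Proof. by move=> mE; exact: measurable_indic. Qed.

Let mdiff := @measurable_EFin_dist d T R D.

Lemma indic_approx_closure E : measurable E ->
  (forall e : R, 0 < e -> exists F, [/\ measurable F, indic_approx F &
    (\int[mu]_(t in D) `|\1_E t - \1_F t|%:E <= e%:E)%E]) ->
  indic_approx E.
Proof.
move=> mE H e e0; have e2 : 0 < e / 2 by rewrite divr_gt0.
have [F [mF aF EF]] := H _ e2; have [q Qq Fq] := aF _ e2.
exists q => //; rewrite [e]splitr EFinD; apply: le_trans (leeD EF Fq).
rewrite -ge0_integralD//; [|exact: mdiff (mind mE) (mind mF)|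
  exact: mdiff (mind mF) (Qmeas Qq)].
apply: ge0_le_integral => //.
- exact: mdiff (mind mE) (Qmeas Qq).
- by apply: emeasurable_funD; [exact: mdiff (mind mE) (mind mF)|
    exact: mdiff (mind mF) (Qmeas Qq)].
- by move=> t _; rewrite -EFinD lee_fin ler_distD.
Qed.

(** The two indicators differ at most on [N], so their L^1 distance is 0. This carries
    approximability from Borel to Lebesgue sets. *)
Lemma indic_approx_negligible E F N : measurable E -> measurable F ->
  measurable N -> mu N = 0%E -> (forall t, ~ N t -> E t <-> F t) ->
  indic_approx F -> indic_approx E.
Proof.
move=> mE mF mN N0 EF aF; apply: indic_approx_closure => // e e0.
exists F; split=> //.
apply: (@le_trans _ _ (mu N)); last by rewrite N0 lee_fin ltW.
apply: (@le_trans _ _ (\int[mu]_(t in D) (\1_N t)%:E)%E).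
  apply: ge0_le_integral => //.
  - exact: mdiff (mind mE) (mind mF).
  - exact/measurable_EFinP/mind.
  - move=> t _; rewrite lee_fin !indicE.
    have [Nt|/negP Nt] := boolP (t \in N).
      by case: (t \in E); case: (t \in F);
        rewrite /= ?subrr ?subr0 ?sub0r ?normrN ?normr1 ?normr0.
    have -> : (t \in E) = (t \in F); last by rewrite subrr normr0.
    have {}Nt : ~ N t by move=> /mem_set.
    by apply/idP/idP; rewrite !inE => /(EF _ Nt).
rewrite integral_indic//; apply: le_measure; rewrite ?inE//; exact: measurableI.
Qed.

Lemma indic_approx0 : indic_approx set0.
Proof.
move=> e e0; exists (fun=> 0) => //.
by rewrite integral0_eq ?lee_fin ?ltW// => t _; rewrite indic0 subr0 normr0.
Qed.

Lemma indic_approxC E : indic_approx E -> indic_approx (~` E).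
Proof.
move=> aE e /aE[q Qq Eq]; exists (fun t => 1 - q t); first exact: QC.
rewrite (eq_integral (fun t => `|\1_E t - q t|%:E))// => t _.
rewrite (_ : \1_(~` E) t = 1 - \1_E t); last first.
  by rewrite !indicE in_setC; case: (_ \in _); rewrite /= ?subrr ?subr0.
by rewrite -normrN; congr (`|_|%:E); ring.
Qed.

Lemma indic_approxI E F : measurable E -> measurable F ->
  indic_approx E -> indic_approx F -> indic_approx (E `&` F).
Proof.
move=> mE mF aE aF e e0; have e2 : 0 < e / 2 by rewrite divr_gt0.
have [q Qq Eq] := aE _ e2; have [r Qr Fr] := aF _ e2.
exists (fun t => q t * r t); first exact: QM.
rewrite [e]splitr EFinD; apply: le_trans (leeD Eq Fr).
have m1 := mdiff (mind mE) (Qmeas Qq); have m2 := mdiff (mind mF) (Qmeas Qr).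
rewrite -ge0_integralD//; apply: ge0_le_integral => //.
- by apply: mdiff; [exact/mind/measurableI|exact: Qmeas (QM Qq Qr)].
- exact: emeasurable_funD.
- move=> t _; rewrite -EFinD lee_fin indicI /=.
  (* Each error is multiplied by a factor in [0, 1], so the two L^1 errors simply add up. *)
  have -> : \1_E t * \1_F t - q t * r t =
    (\1_E t - q t) * \1_F t + q t * (\1_F t - r t) :> R by ring.
  rewrite (le_trans (ler_normD _ _))// !normrM lerD//.
    rewrite ler_piMr// indicE; case: (_ \in _); by rewrite ?normr1 ?normr0.
  by have /andP[q0 q1] := Q01 t Qq; rewrite ler_piMl// ger0_norm.
Qed.

(** Finite unions come from complements and intersections. A countable union is approximated by
    finite ones: since [D] has finite measure, continuity from above makes the missing part
    small. *)
Lemma indic_approx_sigma_algebra :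
  sigma_algebra setT [set E | measurable E /\ indic_approx E].
Proof.
have HC E : measurable E /\ indic_approx E -> measurable (~` E) /\ indic_approx (~` E).
  by move=> [mE aE]; split; [exact: measurableC|exact: indic_approxC].
split.
- by split => //; exact: indic_approx0.
- by move=> E; rewrite setTD; exact: HC.
move=> F FQ; pose G n := \big[setU/set0]_(k < n) F k.
have mF n : measurable (F n) by have [] := FQ n.
have mUF : measurable (\bigcup_n F n) by exact: bigcupT_measurable.
have mG n : measurable (G n) by exact: bigsetU_measurable.
have aG n : indic_approx (G n).
  suff [] : measurable (G n) /\ indic_approx (G n) by [].
  rewrite /G; elim: n => [|n [IH1 IH2]].
    by rewrite big_ord0; split => //; exact: indic_approx0.
  rewrite big_ord_recr/=.
  have [mn an] := HC _ (FQ n); have [mn' an'] := HC _ (conj IH1 IH2).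
  have [] := HC _ (conj (measurableI _ _ mn' mn) (indic_approxI mn' mn an' an)).
  by rewrite setCI !setCK.
split=> //; apply: indic_approx_closure => // e e0.
(* The part of the union in [D] missed by the first [n] sets; it decreases to the empty set. *)
pose H n := D `&` (\bigcup_n F n `\` G n).
have mH n : measurable (H n) by apply: measurableI => //; exact: measurableD.
have GU n : G n `<=` \bigcup_n F n.
  by rewrite /G -bigcup_mkord => t [k _ Fk]; exists k.
have H0 : \bigcap_n H n = set0.
  apply/seteqP; split=> // t Ht.
  have [_ [[k _ Fkt] _]] := Ht 0%N I; have [_ [_ ]] := Ht k.+1 I.
  by apply; rewrite /G -bigcup_mkord; exists k => /=.
have Hcvg : mu (H n) @[n --> \oo] --> 0%E.
  rewrite -[0%E](@measure0 _ _ _ mu) -H0; apply: nonincreasing_cvg_mu => //.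
  - apply: le_lt_trans muD; apply: le_measure; rewrite ?inE//.
    exact: subIsetl.
  - by rewrite H0.
  - move=> m n mn; apply/subsetPset => t [Dt [Ut Gt]]; split => //; split => //.
    apply: contra_not Gt; rewrite /G -!bigcup_mkord => -[k /= km Fk].
    by exists k => //=; exact: leq_trans km mn.
have [n Hn] : exists n, (mu (H n) <= e%:E)%E.
  move/fine_cvgP : Hcvg => [[N1 _ finH]] /cvgrPdist_le/(_ _ e0)[N2 _ Hle].
  exists (maxn N1 N2).
  have fH := finH _ (leq_maxl N1 N2); have := Hle _ (leq_maxr N1 N2).
  by rewrite sub0r normrN /= => /(le_trans (ler_norm _)); rewrite -lee_fin fineK.
exists (G n); split => //; apply: le_trans Hn.
rewrite /H setIC -integral_indic//; last exact: measurableD.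
rewrite le_eqVlt; apply/orP; left; apply/eqP; apply: eq_integral => t _.
have GUt := GU n t; rewrite !indicE in_setD.
have [Ut|Ut] := boolP (t \in \bigcup_n F n).
  by case: (t \in G n); rewrite ?subrr ?subr0 ?normr0 ?normr1.
have -> : (t \in G n) = false.
  by apply: contraNF Ut; rewrite !inE; exact: GU.
by rewrite subrr normr0.
Qed.

End IndicatorApproximation.

(** * From indicators to L^2 *)

Section L2Density.
Import HBNNSimple.
Context d (T : measurableType d) (R : realType).
Variables (mu : {measure set T -> \bar R}) (D : set T).
Hypothesis mD : measurable D.
Variable V : set (T -> R[i]).
Hypothesis Vmeas : forall p, V p -> cmeas D p.
Hypothesis VD : forall p q, V p -> V q -> V (fun t => p t + q t).
Hypothesis VZ : forall c p, V p -> V (fun t => c * p t).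
Local Notation sqn := (sqnorm mu D).

(** Here [e] bounds the square of the distance. [V] is later the space of trigonometric
    polynomials. *)
Definition l2_approx (h : T -> R[i]) := forall e : R, 0 < e ->
  exists2 p, V p & (sqn (fun t => h t - p t)%R <= e%:E)%E.

Hypothesis Vindic : forall E, measurable E -> l2_approx (fun t => (\1_E t)%:C).

Lemma l2_approxD g h : cmeas D g -> cmeas D h -> l2_approx g -> l2_approx h ->
  l2_approx (fun t => g t + h t).
Proof.
(* [sqnormD] doubles each of the two errors, hence a quarter of [e] for each. *)
move=> mg mh ag ah e e0; have e4 : 0 < e / 4 by rewrite divr_gt0.
have [p Vp gp] := ag _ e4; have [q Vq hq] := ah _ e4.
exists (fun t => p t + q t); first exact: VD.
rewrite (_ : (fun t => _) = (fun t => (g t - p t) + (h t - q t))); last first.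
  by apply/funext => t; rewrite opprD addrACA.
apply: le_trans (sqnormD mu mD (cmeasB mg (Vmeas Vp)) (cmeasB mh (Vmeas Vq))) _.
rewrite (_ : e%:E = 2%:E * (e / 4)%:E + 2%:E * (e / 4)%:E)%E; last first.
  by rewrite -!EFinM -EFinD; congr EFin; field.
by rewrite leeD// lee_pmul2l.
Qed.

Lemma l2_approxZ c h : cmeas D h -> l2_approx h -> l2_approx (fun t => c * h t).
Proof.
move=> mh ah e e0.
(* Adding 1 keeps the divisor positive when [c] is 0. *)
have c1 : 0 < normc c ^+ 2 + 1 by rewrite ltr_wpDl ?sqr_ge0.
have [p Vp hp] := ah _ (divr_gt0 e0 c1).
exists (fun t => c * p t); first exact: VZ.
rewrite (_ : (fun t => _) = (fun t => c * (h t - p t))); last first.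
  by apply/funext => t; rewrite mulrBr.
rewrite (sqnormZ mu mD c (cmeasB mh (Vmeas Vp))).
apply: (@le_trans _ _ ((normc c ^+ 2)%:E * (e / (normc c ^+ 2 + 1))%:E)%E).
  by rewrite lee_wpmul2l// lee_fin sqr_ge0.
rewrite -EFinM lee_fin mulrCA ler_piMr// ?ltW//.
by rewrite ltr_pdivrMr// mul1r ltrDl.
Qed.

Lemma l2_approx_closure h : cmeas D h ->
  (forall e : R, 0 < e -> exists g, [/\ cmeas D g, l2_approx g &
    (sqn (fun t => h t - g t)%R <= e%:E)%E]) -> l2_approx h.
Proof.
move=> mh H e e0; have e4 : 0 < e / 4 by rewrite divr_gt0.
have [g [mg ag hg]] := H _ e4; have [p Vp gp] := ag _ e4.
exists p => //.
rewrite (_ : (fun t => _) = (fun t => (h t - g t) + (g t - p t))); last first.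
  by apply/funext => t; rewrite addrA subrK.
apply: le_trans (sqnormD mu mD (cmeasB mh mg) (cmeasB mg (Vmeas Vp))) _.
rewrite (_ : e%:E = 2%:E * (e / 4)%:E + 2%:E * (e / 4)%:E)%E; last first.
  by rewrite -!EFinM -EFinD; congr EFin; field.
by rewrite leeD// lee_pmul2l.
Qed.

Lemma cmeas_real (u : T -> R) : measurable_fun D u -> cmeas D (fun t => (u t)%:C).
Proof. by move=> mu0; split => //=; exact: measurable_cst. Qed.

Lemma l2_approx_sfun (f : {nnsfun T >-> R}) : l2_approx (fun t => (f t)%:C).
Proof.
have -> : (fun t => (f t)%:C) = (fun t => \sum_(y <- fset_set (range f))
    y%:C * (\1_(f @^-1` [set y]) t)%:C).
  apply/funext => t; rewrite fimfunE fsbig_finite//= rmorph_sum/=.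
  by apply: eq_bigr => y _; rewrite rmorphM.
have mE y : measurable (f @^-1` [set y]) by exact: measurable_sfunP.
have mind y : cmeas D (fun t => (\1_(f @^-1` [set y]) t : R)%:C).
  by apply: cmeas_real; exact: measurable_indic.
elim: (finmap.enum_fset _) => [|y r IH].
  (* The empty sum is approximated as the indicator of the empty set. *)
  under eq_fun do rewrite big_nil; move=> e /(Vindic measurable0)[p Vp H].
  by exists p => //; move: H; rewrite indic0.
under eq_fun do rewrite big_cons; apply: l2_approxD => //.
- by apply: cmeasM => //; exact: cmeas_cst.
- by apply: cmeas_sum => // k; apply: cmeasM => //; exact: cmeas_cst.
- by apply: l2_approxZ => //; exact: Vindic.
Qed.

(** Simple functions between 0 and [u] converge to [u] pointwise. The squared errors are dominated
    by [u ^+ 2], so dominated convergence gives convergence in L^2. *)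
Lemma l2_approx_nonneg (u : T -> R) : measurable_fun D u -> (forall t, 0 <= u t) ->
  (\int[mu]_(t in D) (u t ^+ 2)%:E < +oo)%E -> l2_approx (fun t => (u t)%:C).
Proof.
move=> mu0 u0 uoo; apply: l2_approx_closure => [|e e0]; first exact: cmeas_real.
have mEu : measurable_fun D (EFin \o u) by exact/measurable_EFinP.
pose f := nnsfun_approx mD mEu.
have u0' t : D t -> (0 <= (EFin \o u) t)%E by rewrite lee_fin.
have fu t n : D t -> 0 <= f n t <= u t.
  move=> Dt; apply/andP; split; first exact: fun_ge0.
  by rewrite -lee_fin nnsfun_approxE; exact: le_approx.
have mf n : measurable_fun D (f n) by exact: measurable_funTS.
pose F n t := ((u t - f n t) ^+ 2)%:E.
have mF n : measurable_fun D (F n).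
  by apply/measurable_EFinP/measurable_funX/measurable_funB.
have F0 : {ae mu, forall t, D t -> F ^~ t @ \oo --> 0%E}.
  apply: aeW => t Dt; apply/fine_cvgP; split; first exact: nearW.
  suff : (u t - f n t) ^+ 2 @[n --> \oo] --> (u t - u t) ^+ 2.
    by rewrite subrr expr0n.
  have fcvg : u t - f n t @[n --> \oo] --> u t - u t.
    apply: cvgB; first exact: cvg_cst.
    by have /fine_cvgP[] := cvg_nnsfun_approx mD mEu u0' Dt.
  by under eq_fun do rewrite expr2; rewrite expr2; exact: cvgM.
have iu2 : mu.-integrable D (fun t => (u t ^+ 2)%:E).
  apply/integrableP; split; first exact/measurable_EFinP/measurable_funX.
  by under eq_integral do rewrite /= ger0_norm ?sqr_ge0//.
have Fu : {ae mu, forall t n, D t -> (`|F n t| <= (u t ^+ 2)%:E)%E}.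
  apply: aeW => t n Dt; rewrite /= ger0_norm ?sqr_ge0// lee_fin.
  by have /andP[f0 fut] := fu t n Dt; nra.
have [_ _] := dominated_convergence mD mF (measurable_cst 0%E) F0 iu2 Fu.
rewrite integral0 => /fine_cvgP[[N1 _ fin]] /cvgrPdist_le/(_ _ e0)[N2 _ le].
pose n := maxn N1 N2.
exists (fun t => (f n t)%:C); split.
- exact: cmeas_real.
- exact: l2_approx_sfun.
have fH := fin _ (leq_maxl N1 N2); have := le _ (leq_maxr N1 N2).
rewrite sub0r normrN /= => /(le_trans (ler_norm _)); rewrite -lee_fin fineK//.
apply: le_trans; rewrite le_eqVlt; apply/orP; left; apply/eqP.
by apply: eq_integral => t _; rewrite -rmorphB/= expr0n addr0 sqr_sqrtr ?sqr_ge0.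
Qed.

Theorem l2_approx_all h : cmeas D h -> (sqn h < +oo)%E -> l2_approx h.
Proof.
move=> mh hoo; case: (mh) => m1 m2.
have H (u : T -> R) : measurable_fun D u -> (forall t, `|u t| <= normc (h t)) ->
    cmeas D (fun t => (u t)%:C) /\ l2_approx (fun t => (u t)%:C).
  move=> mu0 uh; split; first exact: cmeas_real.
  (* The positive part of [v]; applied to [u] and to [- u] it yields both parts of [u]. *)
  have P (v : T -> R) : measurable_fun D v -> (forall t, `|v t| <= normc (h t)) ->
      l2_approx (fun t => (Num.max (v t) 0)%:C).
    move=> mv vh; apply: l2_approx_nonneg.
    - exact: measurable_maxr.
    - by move=> t; rewrite le_max lexx orbT.
    - apply: le_lt_trans hoo; apply: ge0_le_integral => //.
      + by move=> t _; rewrite lee_fin sqr_ge0.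
      + exact/measurable_EFinP/measurable_funX/measurable_maxr.
      + exact/measurable_EFinP/measurable_sqr_normc.
      + move=> t _; rewrite lee_fin ler_sqr ?nnegrE ?normc_ge0//; last first.
          by rewrite le_max lexx orbT.
        rewrite (le_trans _ (vh t))// ge_max normr_ge0 andbT; exact: ler_norm.
  have mN : measurable_fun D (fun t => - u t) by exact: measurable_funN.
  rewrite (_ : (fun t => _) = (fun t =>
      (Num.max (u t) 0)%:C + (-1) * (Num.max (- u t) 0)%:C)); last first.
    apply/funext => t; rewrite mulN1r -rmorphB/=; congr (_%:C).
    by case: (leP (u t) 0); case: (leP (- u t) 0) => *; lra.
  apply: l2_approxD.
  - by apply: cmeas_real; exact: measurable_maxr.
  - apply: (cmeasM (cmeas_cst _ _)).
    by apply: cmeas_real; exact: measurable_maxr.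
  - exact: P.
  - apply: l2_approxZ; first by apply: cmeas_real; exact: measurable_maxr.
    by apply: P => // t; rewrite normrN.
have [mR aR] := H _ m1 (fun t => Re_le_normc (h t)).
have [mI aI] := H _ m2 (fun t => Im_le_normc (h t)).
rewrite (_ : h = (fun t => (Re (h t))%:C + 'i%C * (Im (h t))%:C)); last first.
  by apply/funext => t; rewrite -complexE.
apply: l2_approxD => //; last exact: l2_approxZ.
by apply: cmeasM => //; exact: cmeas_cst.
Qed.

End L2Density.

(** * Density of trigonometric polynomials *)

Section Smoothstep.
Context {R : realType}.
Implicit Types y z : R.

(** The cubic 3 y^2 - 2 y^3 fixes 0, 1/2 and 1 and commutes with the reflection of y to 1 - y. Its
    iterates on [0, 1] push values away from 1/2 towards the ends. *)
Definition smoothstep y : R := y ^+ 2 * (3 - 2 * y).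

Lemma smoothstep01 y : 0 <= y <= 1 -> 0 <= smoothstep y <= 1.
Proof.
move=> /andP[y0 y1]; rewrite /smoothstep; apply/andP; split.
  by rewrite mulr_ge0 ?sqr_ge0//; lra.
rewrite -subr_ge0 (_ : _ - _ = (1 - y) ^+ 2 * (1 + 2 * y)); last by ring.
by rewrite mulr_ge0 ?sqr_ge0//; lra.
Qed.

Lemma iter_smoothstep01 n y : 0 <= y <= 1 -> 0 <= iter n smoothstep y <= 1.
Proof. by elim: n => //= n IH /IH; exact: smoothstep01. Qed.

Lemma iter_smoothstepC n y : iter n smoothstep (1 - y) = 1 - iter n smoothstep y.
Proof. by elim: n => //= n ->; rewrite /smoothstep; ring. Qed.

(** Geometric decay with ratio r = 3 y - 2 y^2, where 1 - r = (1 - y) (1 - 2 y) is positive. The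
    ratio valid at [y] remains valid at smaller points, so the induction also records that the
    iterates stay below [y]. *)
Lemma cvg_smoothstep0 y : 0 <= y < 2^-1 ->
  iter n smoothstep y @[n --> \oo] --> (0 : R).
Proof.
move=> /andP[y0 y2]; pose r := 3 * y - 2 * y ^+ 2.
have r0 : 0 <= r by rewrite /r; nra.
have r1 : r < 1 by rewrite /r; nra.
have H n : 0 <= iter n smoothstep y <= y /\ iter n smoothstep y <= r ^+ n * y.
  elim: n => [|n [/andP[z0 zy] IH]]; first by rewrite /= expr0 mul1r lexx y0.
  move: z0 zy IH; rewrite iterS; set z := iter n _ _ => z0 zy IH.
  have sz : smoothstep z <= r * z.
    rewrite /smoothstep (_ : _ * _ = (3 * z - 2 * z ^+ 2) * z); last by ring.
    rewrite ler_wpM2r// /r -subr_ge0.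
    by rewrite (_ : _ - _ = (y - z) * (3 - 2 * (y + z))); [apply: mulr_ge0; lra|ring].
  have s0 : 0 <= smoothstep z by rewrite /smoothstep mulr_ge0 ?sqr_ge0//; lra.
  split; first by rewrite s0 (le_trans sz)// (le_trans _ zy)// ler_piMl// ltW.
  by rewrite (le_trans sz)// exprS -mulrA ler_wpM2l.
apply: (@squeeze_cvgr _ _ _ _ (fun=> 0) (fun n => r ^+ n * y)).
- by apply: nearW => n; have [/andP[-> _] ->] := H n.
- exact: cvg_cst.
- rewrite -[0](mul0r y); apply: cvgM; last exact: cvg_cst.
  by apply: cvg_expr; rewrite ger0_norm.
Qed.

Lemma cvg_smoothstep1 y : 2^-1 < y <= 1 ->
  iter n smoothstep y @[n --> \oo] --> (1 : R).
Proof.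
move=> /andP[y2 y1].
rewrite (_ : (fun n => _) = (fun n => 1 - iter n smoothstep (1 - y))); last first.
  by apply/funext => n; rewrite iter_smoothstepC opprB addrC subrK.
rewrite -[X in _ --> X]subr0; apply: cvgB; first exact: cvg_cst.
by apply: cvg_smoothstep0; apply/andP; split; lra.
Qed.

End Smoothstep.

Section TrigonometricDensity.
Context {R : realType}.
Notation mu := (@leb R).
Notation P := (@period R).
Implicit Types q r : R -> R.

Let mP : measurable (P : set lebesgueType) := @measurable_period R.

Definition rtrig q := trig (fun t => (q t)%:C).

Lemma rtrig_cst c : rtrig (fun=> c).
Proof. exact: trig_cst. Qed.

Lemma rtrigD q r : rtrig q -> rtrig r -> rtrig (fun t => q t + r t).
Proof.
move=> tq tr; rewrite /rtrig; under eq_fun do rewrite rmorphD.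
exact: trig_add.
Qed.

Lemma rtrigM q r : rtrig q -> rtrig r -> rtrig (fun t => q t * r t).
Proof.
move=> tq tr; rewrite /rtrig; under eq_fun do rewrite rmorphM.
exact: trig_mul.
Qed.

Lemma rtrigC q c : rtrig q -> rtrig (fun t => c - q t).
Proof.
move=> tq; under eq_fun do rewrite -mulN1r.
by apply: rtrigD; [exact: rtrig_cst|apply: rtrigM => //; exact: rtrig_cst].
Qed.

Lemma cexp1 (t : R) : cexp 1 t = cos t +i* sin t.
Proof. by rewrite /cexp mulr1z mul1r. Qed.

Lemma cexpN1 (t : R) : cexp (-1) t = cos t -i* sin t.
Proof. by rewrite -conjc_cexp cexp1. Qed.

Lemma rtrig_cos : rtrig cos.
Proof.
rewrite /rtrig (_ : (fun t => _) = (fun t : R =>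
    (2^-1)%:C * cexp 1 t + (2^-1)%:C * cexp (-1) t)).
  by apply: trig_add; exact: trig_monomial.
apply/funext => t; rewrite cexp1 cexpN1.
by apply: eq_ReIm; rewrite ?ReD ?ImD ?ReM ?ImM /=; field.
Qed.

Lemma rtrig_sin : rtrig sin.
Proof.
rewrite /rtrig (_ : (fun t => _) = (fun t : R =>
    (0 -i* 2^-1) * cexp 1 t + (0 +i* 2^-1) * cexp (-1) t)).
  by apply: trig_add; exact: trig_monomial.
apply/funext => t; rewrite cexp1 cexpN1.
by apply: eq_ReIm; rewrite ?ReD ?ImD ?ReM ?ImM /=; field.
Qed.

Lemma rtrig_smoothstep n q : rtrig q -> rtrig (fun t => iter n smoothstep (q t)).
Proof.
move=> tq; elim: n => //= n IH; rewrite /smoothstep.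
under eq_fun do rewrite expr2.
apply: rtrigM; first exact: rtrigM.
by apply: rtrigC; apply: rtrigM => //; exact: rtrig_cst.
Qed.

(* On (0, 2 pi), [cos (a/2) - cos (t - a/2) = 2 sin (t/2) sin ((t - a)/2)] has
   the sign of [t - a]; it is rescaled into [0, 1]. *)
Definition ray_poly (a t : R) : R := (cos (a / 2) - cos (t - a / 2)) / 4 + 2^-1.

Lemma rtrig_ray_poly a : rtrig (ray_poly a).
Proof.
rewrite /ray_poly; apply: rtrigD; last exact: rtrig_cst.
apply: rtrigM; last exact: rtrig_cst.
apply: rtrigC; under eq_fun do rewrite cosB.
by apply: rtrigD; apply: rtrigM; try exact: rtrig_cst; [exact: rtrig_cos|exact: rtrig_sin].
Qed.

Lemma ray_poly01 a t : 0 <= ray_poly a t <= 1.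
Proof.
have := cos_le1 (a / 2); have := cos_geN1 (a / 2).
have := cos_le1 (t - a / 2); have := cos_geN1 (t - a / 2).
by rewrite /ray_poly => *; apply/andP; split; lra.
Qed.

Lemma ray_polyE a t :
  ray_poly a t = sin (t / 2) * sin ((t - a) / 2) / 2 + 2^-1.
Proof.
rewrite /ray_poly (_ : t - a / 2 = t / 2 + (t - a) / 2); last by field.
rewrite [X in cos X - _](_ : a / 2 = t / 2 - (t - a) / 2); last by field.
by rewrite cosB cosD; field.
Qed.

(** Both t/2 and (t - a)/2 lie in (0, pi), where the sine is positive. To the left of [a] the second
    angle lies in (-pi, 0) instead. *)
Lemma ray_poly_gt a t : 0 <= a -> a < t < 2 * pi -> 2^-1 < ray_poly a t.
Proof.
move=> a0 /andP[ta t2]; rewrite ray_polyE ltrDr !mulr_gt0//.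
- by apply: sin_gt0_pi; apply/andP; split; lra.
- by apply: sin_gt0_pi; apply/andP; split; lra.
Qed.

Lemma ray_poly_lt a t : a <= 2 * pi -> 0 < t < a -> ray_poly a t < 2^-1.
Proof.
move=> a2 /andP[t0 ta]; rewrite ray_polyE gtrDr pmulr_llt0//.
have s1 : 0 < sin (t / 2) by apply: sin_gt0_pi; apply/andP; split; lra.
rewrite pmulr_rlt0// -oppr_gt0 -sinN.
by apply: sin_gt0_pi; apply/andP; split; lra.
Qed.

Definition rtrig01 : set (lebesgueType -> R) :=
  [set q | rtrig q /\ forall t, 0 <= q t <= 1].

Lemma rtrig01_measurable q : rtrig01 q ->
  measurable_fun (P : set lebesgueType) (q : lebesgueType -> R).
Proof. by move=> [/l2_trig[[mq _] _] _]. Qed.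

Lemma ray_approx (a : R) : indic_approx mu P rtrig01 `]a, +oo[%classic.
Proof.
(* For negative [a] the ray contains the whole period, and for [a] above 2 pi it misses it;
   constants are then exact. *)
have [a0|a0] := ltP a 0.
  move=> e e0; exists (fun=> 1).
    by split; [exact: rtrig_cst|move=> t; rewrite ler01 lexx].
  rewrite integral0_eq ?lee_fin ?ltW// => t.
  rewrite /period /= in_itv/= => /andP[t0 _].
  by rewrite indicE mem_set/= ?in_itv/= ?andbT ?(lt_le_trans a0)// subrr normr0.
have [a2|a2] := ltP (2 * pi) a.
  move=> e e0; exists (fun=> 0).
    by split; [exact: rtrig_cst|move=> t; rewrite ler01 lexx].
  rewrite integral0_eq ?lee_fin ?ltW// => t.
  rewrite /period /= in_itv/= => /andP[_ t2].
  rewrite indicE memNset/= ?subrr ?normr0// in_itv/= andbT.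
  move=> /lt_trans/(_ (le_lt_trans t2 a2)).
  by rewrite ltxx.
pose E : set lebesgueType := `]a, +oo[%classic.
have mE : measurable E by exact: measurable_itv_lebesgue.
have mE1 : measurable_fun (P : set lebesgueType) (\1_E : _ -> R).
  exact: measurable_indic.
pose q n t := iter n smoothstep (ray_poly a t).
have Qq n : rtrig01 (q n).
  split; first exact/rtrig_smoothstep/rtrig_ray_poly.
  by move=> t; exact/iter_smoothstep01/ray_poly01.
pose F n (t : lebesgueType) := (`|\1_E t - q n t|%:E)%E.
have mF n : measurable_fun (P : set lebesgueType) (F n).
  exact: (measurable_EFin_dist mE1 (rtrig01_measurable (Qq n))).
have F0 : {ae mu, forall t, P t -> F ^~ t @ \oo --> 0%E}.
  (* At these points [ray_poly a] equals 1/2, the fixed point of [smoothstep] from which the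
     iterates never move. *)
  pose N : set R := [set 0] `|` [set a] `|` [set 2 * pi].
  exists N; split.
  - by apply: borel_lebesgue_measurable; do 2 apply: measurableU => //.
  - rewrite lebE; apply: countable_lebesgue_measure0.
    by apply: finite_set_countable; rewrite !finite_setU.
  move=> t /=; apply: contra_notP => Nt; rewrite /period/= in_itv/= => /andP[t0 t2].
  have {}t0 : 0 < t.
    rewrite lt_neqAle t0 andbT; apply/eqP => t0'; apply: Nt; left; left.
    by rewrite /= -t0'.
  have {}t2 : t < 2 * pi.
    rewrite lt_neqAle t2 andbT; apply/eqP => t2'; apply: Nt; right.
    by rewrite /= t2'.
  apply/fine_cvgP; split; first exact: nearW.
  suff qt : q n t @[n --> \oo] --> (\1_E t : R).
    suff : `|\1_E t - q n t| @[n --> \oo] --> `|\1_E t - \1_E t : R|.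
      by rewrite subrr normr0.
    by apply: cvg_norm; apply: cvgB => //; exact: cvg_cst.
  have [ta|ta|ta] := ltgtP t a.
  - rewrite indicE memNset/=; last first.
      by rewrite /E /= in_itv/= andbT => /lt_trans/(_ ta); rewrite ltxx.
    apply: cvg_smoothstep0; have /andP[-> _] := ray_poly01 a t.
    by rewrite /= ray_poly_lt// t0.
  - rewrite indicE mem_set/=; last by rewrite /E /= in_itv/= andbT.
    apply: cvg_smoothstep1; have /andP[_ ->] := ray_poly01 a t.
    by rewrite andbT ray_poly_gt// ta.
  - by exfalso; apply: Nt; left; right.
have i1 : mu.-integrable P (cst 1%E).
  apply/integrableP; split; first exact: measurable_cst.
  rewrite (eq_integral (cst 1%E)) ?integral_cst// ?leb_period ?mul1e ?ltry//.
  by move=> t _; rewrite /= normr1.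
have F1 : {ae mu, forall t n, P t -> (`|F n t| <= cst 1 t)%E}.
  apply: aeW => t n _; rewrite /F /= ger0_norm// lee_fin.
  have /andP[q0 q1] := (Qq n).2 t.
  rewrite indicE; case: (_ \in _); rewrite /= ?sub0r ?normrN ger0_norm//.
    by rewrite gerBl.
  by rewrite subr_ge0.
have [_ _] := dominated_convergence mP mF (measurable_cst 0%E) F0 i1 F1.
rewrite integral0 => /fine_cvgP[[N1 _ fin]] /cvgrPdist_le Hcvg e e0.
have [N2 _ le] := Hcvg _ e0; pose n := maxn N1 N2.
exists (q n) => //.
have fH := fin _ (leq_maxl N1 N2); have := le _ (leq_maxr N1 N2).
by rewrite sub0r normrN /= => /(le_trans (ler_norm _)); rewrite -lee_fin fineK.
Qed.

Lemma lebesgue_set_approx (E : set lebesgueType) :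
  measurable E -> indic_approx mu P rtrig01 E.
Proof.
have Qm := rtrig01_measurable.
have Q01 (q : lebesgueType -> R) t : rtrig01 q -> 0 <= q t <= 1 by case.
have Q0 : rtrig01 (fun=> 0).
  by split; [exact: rtrig_cst|move=> t; rewrite lexx ler01].
have QC q : rtrig01 q -> rtrig01 (fun t => 1 - q t).
  move=> [tq q01]; split; first exact: rtrigC.
  by move=> t; have /andP[q0 q1] := q01 t; rewrite subr_ge0 q1 gerBl.
have QM q r : rtrig01 q -> rtrig01 r -> rtrig01 (fun t => q t * r t).
  move=> [tq q01] [tr r01]; split; first exact: rtrigM.
  move=> t; have /andP[q0 q1] := q01 t; have /andP[r0 r1] := r01 t.
  by rewrite mulr_ge0// mulr_ile1.
have Pfin : (mu P < +oo)%E by rewrite leb_period ltry.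
have sigma := indic_approx_sigma_algebra mP Pfin Qm Q01 Q0 QC QM.
have borel (A : set (measurableTypeR R)) : measurable A -> indic_approx mu P rtrig01 A.
  move=> mA.
  have {}mA : (@RGenOInfty.G R).-sigma.-measurable A.
    by rewrite -RGenOInfty.measurableE.
  suff [] : measurable (A : set lebesgueType) /\ indic_approx mu P rtrig01 A by [].
  move: A mA; apply: smallest_sub => // _ [a ->].
  by split; [exact: measurable_itv_lebesgue|exact: ray_approx].
move=> mE.
have : (completed_algebra_gen (@lebesgue_measure R)).-sigma.-measurable E.
  by rewrite completed_caratheodory_measurable.
(* [E] is a Borel set [A] together with a subset of a Borel null set [B], so [E] and [A] agree off
   [B]. *)
rewrite g_sigma_completed_algebra_genE => -[A mA [N [B [mB B0 NB]] EAN]].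
have mA' := borel_lebesgue_measurable mA.
have mB' := borel_lebesgue_measurable mB.
have B0' : mu (B : set lebesgueType) = 0%E by [].
apply: (indic_approx_negligible mP Qm mE mA' mB' B0' _ (borel _ mA)) => t Bt.
by rewrite -EAN; split=> [[//|/NB]|]; [|left].
Qed.

Theorem trig_dense (h : R -> R[i]) : l2 h -> forall e : R, 0 < e ->
  exists2 p, trig p & (sqnorm mu P (fun t => h t - p t)%R <= e%:E)%E.
Proof.
move=> [mh hoo].
have Vmeas (p : lebesgueType -> R[i]) : trig p -> cmeas (P : set lebesgueType) p.
  by move=> /l2_trig[].
have VZ (c : R[i]) (p : lebesgueType -> R[i]) : trig p -> trig (fun t => c * p t).
  by move=> tp; apply: trig_mul => //; exact: trig_cst.
apply: (l2_approx_all mP Vmeas (@trig_add R) VZ _ mh hoo) => E mE e e0.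
have [q [tq q01] Eq] := lebesgue_set_approx mE e0.
exists (fun t => (q t)%:C) => //; apply: le_trans Eq.
have mq : measurable_fun (P : set lebesgueType) q by exact: rtrig01_measurable.
have mE1 : measurable_fun (P : set lebesgueType) (\1_E : _ -> R).
  exact: measurable_indic.
apply: ge0_le_integral.
- exact: mP.
- by move=> t _; rewrite lee_fin sqr_ge0.
- apply/measurable_EFinP/measurable_sqr_normc.
  exact: (cmeasB (cmeas_real mE1) (cmeas_real mq)).
- exact: (measurable_EFin_dist mE1 mq).
(* The indicator and [q] have values in [0, 1], so the squared difference is at most the difference:
   L^1 closeness gives L^2 closeness. *)
- move=> t _; rewrite -rmorphB normcC lee_fin real_normK ?num_real//.
  have /andP[q0 q1] := q01 t.
  rewrite indicE; case: (_ \in _) => /=.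
    by rewrite ger0_norm ?subr_ge0//; nra.
  by rewrite sub0r sqrrN normrN ger0_norm//; nra.
Qed.

End TrigonometricDensity.

(** * Amalgam bound *)

Section CountablePartition.
Context d (T : measurableType d) (R : realType) (I : countType).
Variables (mu : {measure set T -> \bar R}) (H : I -> set T).
Hypotheses (mH : forall k, measurable (H k)) (tH : trivIset setT H).
Hypothesis HT : forall t, exists k, H k t.

(** Monotone convergence along finite unions of cells exhausting the space; on each union the
    integral is a finite sum, bounded by the sum of the whole family. *)
Lemma integral_le_esum (F : T -> \bar R) (a : I -> \bar R) (c : \bar R) :
  measurable_fun setT F -> (forall t, 0 <= F t)%E -> (forall k, 0 <= a k)%E ->
  (0 <= c)%E -> (forall k, \int[mu]_(t in H k) F t <= a k * c)%E ->
  (\int[mu]_t F t <= (\esum_(k in [set: I]) a k) * c)%E.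
Proof.
move=> mF F0 a0 c0 Fa.
(* The indices whose code is less than [n], without repetition. *)
pose s n : seq I := pmap (@pickle_inv I) (iota 0 n).
have us n : uniq (s n) := pmap_uniq (@pickle_invK I) (iota_uniq 0 n).
have sE n k : (k \in s n) = (choice.pickle k < n)%N.
  rewrite mem_pmap; apply/mapP/idP => [[m]|kn].
    rewrite mem_iota /= => mn /(congr1 (omap choice.pickle)) /=.
    by have := @pickle_invK I m; case: (pickle_inv m) => //= j pj [->]; rewrite pj.
  by exists (choice.pickle k); [rewrite mem_iota|rewrite pickleK_inv].
pose D n := \big[setU/set0]_(k <- s n) H k.
have DE n : D n = \bigcup_(k in [set` s n]) H k by rewrite /D bigcup_seq.
have mD n : measurable (D n) by exact: bigsetU_measurable.
have DT : \bigcup_n D n = setT.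
  apply/seteqP; split=> // t _; have [k Hk] := HT t.
  by exists (choice.pickle k).+1 => //; rewrite DE; exists k => //=; rewrite sE.
have ndD : nondecreasing_seq D.
  move=> m n mn; apply/subsetPset; rewrite !DE => t [k /=].
  by rewrite sE => km Hk; exists k => //=; rewrite sE (leq_trans km).
have mFD n : measurable_fun (D n) F by exact: measurable_funTS.
have cvgD := @ge0_nondecreasing_set_cvg_integral _ _ _ _ _ mu ndD mD mFD (fun _ t _ => F0 t).
rewrite -DT -(cvg_lim _ cvgD)//; apply: lime_le; first by apply/cvg_ex; eexists; exact: cvgD.
apply: nearW => n.
rewrite (ge0_integral_bigsetU mu mH (us n) (sub_trivIset (@subsetT _ _) tH) (mFD n))//.
apply: (@le_trans _ _ (\sum_(k <- s n) a k * c)%E); first exact: lee_sum.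
rewrite -ge0_sume_distrl//; apply: lee_wpmul2r => //.
by apply: esum_ge; exists [set` s n]; [split => //; exact: finite_seq|rewrite -fsbig_seq].
Qed.

End CountablePartition.

(** Hoelder's inequality with both exponents 2. The indicator, being its own square, is placed on
    both factors, so that the first norm has the form of a term of [amalgam_norm]. *)
Lemma norm1_mul_le d (T : measurableType d) (R : realType)
    (mu : {measure set T -> \bar R}) (A : set T) (u v : T -> R[i]) :
  measurable A -> cmeas setT u -> cmeas setT v ->
  (norm1 mu A (fun t => u t * v t)%R <=
   Lnorm mu 2%:E (fun t => (normc ((\1_A t)%:C * u t))%:E) *
   sqnorm mu A v `^ 2^-1)%E.
Proof.
move=> mA mu0 mv.
have mind (w : T -> R[i]) : cmeas setT w ->
    measurable_fun setT (fun t => normc ((\1_A t)%:C * w t)).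
  move=> mw; apply: measurable_normc => //; apply: cmeasM => //.
  by apply: cmeas_real; exact: measurable_indic.
have p20 : (0 < 2 :> R)%R by [].
have half : (2^-1 + 2^-1 = 1 :> R)%R by field.
have := hoelder mu (mind _ mu0) (mind _ mv) p20 p20 half.
rewrite Lnorm1 => h.
have -> : norm1 mu A (fun t => u t * v t) = (\int[mu]_t
    `|(EFin \o (fun t => normc ((\1_A t)%:C * u t) * normc ((\1_A t)%:C * v t))%R) t|)%E.
  rewrite /norm1 integral_mkcond; apply: eq_integral => t _.
  rewrite patchE /= indicE; case: (t \in A).
    by rewrite !mul1r -Normc.normcM ger0_norm ?normc_ge0.
  by rewrite !mul0r Normc.normc0 mul0r normr0.
suff <- : Lnorm mu 2%:E (EFin \o (fun t => normc ((\1_A t)%:C * v t))) =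
  (sqnorm mu A v `^ 2^-1)%E by exact: h.
rewrite unlock; congr (_ `^ _)%E; rewrite /sqnorm [RHS]integral_mkcond.
apply: eq_integral => t _; rewrite patchE /= indicE ger0_norm ?normc_ge0//.
rewrite -poweR_EFin/= powR_mulrn ?normc_ge0//.
by case: (t \in A); rewrite ?mul1r// mul0r Normc.normc0 expr0n.
Qed.

Section AmalgamBound.
Context {R : realType}.
Notation mu := (@leb R).
Notation P := (@period R).
Notation T := (@lebesgueType R).
Implicit Types f h : R -> R[i].

Lemma measurable_Ik (k : int) : measurable (@Ik R k : set T).
Proof. exact: measurable_itv_lebesgue. Qed.

Lemma sqnorm_Ik h (k : int) : cmeas (setT : set T) h ->
  (forall x, h (x + 2 * pi) = h x) -> sqnorm mu (Ik k) h = sqnorm mu P h.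
Proof.
move=> mh hper; have mI := measurable_Ik k.
rewrite /sqnorm (ge0_integral_leb_shift (2 * pi * k%:~R) mI); last 2 first.
- apply: (measurable_funS measurableT (@subsetT _ _)).
  exact/measurable_EFinP/measurable_sqr_normc.
- by move=> x; rewrite lee_fin sqr_ge0.
rewrite (_ : _ @^-1` _ = P); last first.
  have kE : 2 * pi * (k + 1)%:~R = 2 * pi * k%:~R + 2 * pi :> R.
    by rewrite intrD mulrDr mulr1z mulr1.
  by apply/seteqP; split=> x; rewrite /Ik /period /= !in_itv/= kE => /andP[? ?];
    apply/andP; split; lra.
by apply: eq_integral => x _; rewrite (periodic_int hper).
Qed.

Lemma norm1_le_amalgam f h : cmeas (setT : set T) f -> cmeas (setT : set T) h ->
  (forall x, h (x + 2 * pi) = h x) ->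
  (norm1 mu setT (fun t => f t * h t)%R <=
   amalgam_norm f * sqnorm mu P h `^ 2^-1)%E.
Proof.
move=> mf mh hper.
(* The closed intervals [Ik k] share endpoints; dropping the right endpoint gives a partition, the
   cell of [t] being found by the floor of t/(2 pi). *)
pose H (k : int) : set T := `[2 * pi * k%:~R, 2 * pi * (k + 1)%:~R[%classic.
have Hfloor k t : H k t -> k = Num.floor (t / (2 * pi)).
  rewrite /H /= in_itv/= => /andP[kt tk]; apply/esym/floor_def.
  by rewrite ler_pdivlMr ?pi2_gt0// ltr_pdivrMr ?pi2_gt0// ![_%:~R * _]mulrC kt tk.
have mfh : cmeas (setT : set T) (fun t => f t * h t) by exact: cmeasM.
have mF : measurable_fun (setT : set T) (fun t => (normc (f t * h t))%:E).
  exact/measurable_EFinP/measurable_normc.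
apply: (@integral_le_esum _ T R _ mu H).
- by move=> k; exact: measurable_itv_lebesgue.
- by move=> k l _ _ [t [/Hfloor -> /Hfloor ->]].
- move=> t; exists (Num.floor (t / (2 * pi))); rewrite /H /= in_itv/=.
  rewrite ![2 * pi * _]mulrC -ler_pdivlMr ?pi2_gt0// -ltr_pdivrMr ?pi2_gt0//.
  exact: floor_itv.
- exact: mF.
- by move=> t; rewrite lee_fin normc_ge0.
- by move=> k; exact: Lnorm_ge0.
- exact: poweR_ge0.
move=> k; rewrite -(sqnorm_Ik k mh hper).
apply: le_trans (norm1_mul_le mu (measurable_Ik k) mf mh).
apply: ge0_subset_integral.
- exact: measurable_itv_lebesgue.
- exact: measurable_Ik.
- exact: (measurable_funS measurableT (@subsetT _ _) mF).
- by move=> t _; rewrite lee_fin normc_ge0.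
- by apply: subset_itvl; rewrite bnd_simp.
Qed.

End AmalgamBound.

(** * Convergence of the Fourier series of [g] integrated against [f] *)

Theorem theorem2p1 (R : realType) (f g : R -> R[i])
    (hf : L2loc f) (hg : L2torus g) (hM : (amalgam_norm f < +oo)%E) :
  [/\ cintegrable [set: R] f,
      cintegrable [set: R] (fun x => f x * conjc (g x)) &
      has_sum (fun n : int => fourier f n%:~R * conjc (fourier_coef g n))
        (cintegral [set: R] (fun x => f x * conjc (g x)))].
Proof.
case: hf => mf _; case: hg => mg gper goo.
have mf' : cmeas (setT : set (@lebesgueType R)) f := mf.
have mg' : cmeas (setT : set (@lebesgueType R)) g := mg.
have mPg : cmeas (@period R : set lebesgueType) g.
  by case: mg' => g1 g2; split; exact: (measurable_funS measurableT (@subsetT _ _)).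
have lg : l2 g by split.
have mT : measurable (setT : set (@lebesgueType R)) := measurableT.
have M0 : (0 <= amalgam_norm f)%E by apply: esum_ge0 => k _; exact: Lnorm_ge0.
have Mfin : amalgam_norm f \is a fin_num by rewrite ge0_fin_numE.
have int_mul h : cmeas (setT : set (@lebesgueType R)) h ->
    (forall x, h (x + 2 * pi) = h x) -> (sqnorm leb (@period R) h < +oo)%E ->
    cinteg leb (setT : set (@lebesgueType R)) (fun t => f t * h t).
  move=> mh hper hoo; apply: (cinteg_norm1 mT (cmeasM mf' mh)).
  apply: le_lt_trans (norm1_le_amalgam mf' mh hper) _.
  by rewrite lte_mul_pinfty// poweR_lty.
have me n : cmeas (setT : set (@lebesgueType R)) (cexp n) := cmeas_cexp n mT.
have int_conj h : cmeas (setT : set (@lebesgueType R)) h ->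
    (forall x, h (x + 2 * pi) = h x) -> (sqnorm leb (@period R) h < +oo)%E ->
    cinteg leb (setT : set (@lebesgueType R)) (fun t => f t * conjc (h t)).
  move=> mh hper hoo; apply: int_mul.
  - exact: cmeas_conj.
  - by move=> x; rewrite hper.
  - by rewrite sqnorm_conj.
have int_e n : cinteg leb (setT : set (@lebesgueType R)) (fun t => f t * conjc (cexp n t)).
  exact: (int_conj _ (me n) (@cexp_periodic R n) (l2_cexp n).2).
have fourierE n : fourier f n%:~R =
    cint leb (setT : set (@lebesgueType R)) (fun t => f t * conjc (cexp n t)).
  apply: (@eq_cint _ (@lebesgueType R) R leb setT
    (fun t => f t * expi (- (n%:~R * t)))) => x _.
  by rewrite conjc_expi.
(* The two integrability claims make the integrals in [fourier f] and in the sum meaningful. The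
   first is the case of the constant periodic function 1, written [cexp 0]. *)
split.
- have := int_mul (cexp 0) (me 0) (@cexp_periodic R 0) (l2_cexp 0).2.
  by under eq_fun do rewrite cexp0 mulr1.
- exact: (int_conj g mg' gper goo).
apply/(@cvgrPdist_lt R[i] (R[i])^o _ _ summability.totally_filter) => eps.
(* In the order on complex numbers, a positive [eps] is real. *)
rewrite ltcE => /andP[/= /eqP epsI eps0].
set e := complex.Re eps in eps0.
have [M ME] : exists M : R, amalgam_norm f = M%:E.
  by exists (fine (amalgam_norm f)); rewrite fineK.
have MR0 : 0 <= M by rewrite -lee_fin -ME.
have M1 : 0 < 2 * M + 1 by lra.
(* Chosen so that the final bound 2 M delta is strictly below [e], even when [M] is 0. The density
   result bounds squared norms, so it is applied with the square of [delta]. *)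
pose delta := e / (2 * M + 1).
have delta0 : 0 < delta by exact: divr_gt0.
have [p tp gp] := trig_dense lg (exprn_gt0 2 delta0).
have [A0 HA0] := trig_spectrum tp.
(* Every finite set [B] of frequencies containing the spectrum of [p] must satisfy the estimate. *)
exists [fset n in A0]%fset => // B /= A0B.
have sA0B : {subset A0 <= enum_fset B}.
  by move=> n nA; apply: (fsubsetP A0B); rewrite inE.
have uB : uniq (enum_fset B) := fset_uniq B.
pose S := fourier_partial (enum_fset B) g.
have lS : l2 S by exact: l2_fourier_partial.
have mS : cmeas (setT : set (@lebesgueType R)) S.
  by apply: cmeas_sum => n; apply: cmeasM => //; exact: cmeas_cst.
have Sper x : S (x + 2 * pi) = S x.
  by apply: eq_bigr => n _; rewrite cexp_periodic.
pose r t := g t - S t.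
have mr : cmeas (setT : set (@lebesgueType R)) r := cmeasB mg' mS.
have rper x : r (x + 2 * pi) = r x by rewrite /r gper Sper.
have sumE : summability.partial_sum
    (fun n : int => fourier f n%:~R * conjc (fourier_coef g n)) B =
    cint leb (setT : set (@lebesgueType R)) (fun t => f t * conjc (S t)).
  rewrite /summability.partial_sum -(big_seq_fsetE _ _ xpredT
    (fun n : int => fourier f n%:~R * conjc (fourier_coef g n)))/=.
  transitivity (cint leb (setT : set (@lebesgueType R)) (fun t =>
      \sum_(n <- enum_fset B) conjc (fourier_coef g n) * (f t * conjc (cexp n t)))).
    rewrite (cint_sum mT) => [|n]; last exact: (cintegZ mT _ (int_e n)).
    apply: eq_bigr => n _; rewrite (cintZ mT _ (int_e n)) fourierE.
    exact: mulrC.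
  apply: eq_cint => t _; rewrite conjc_fourier_partial mulr_sumr.
  by apply: eq_bigr => n _; rewrite mulrCA.
rewrite sumE.
have -> : cintegral setT (fun x => f x * conjc (g x)) -
    cint leb (setT : set (@lebesgueType R)) (fun t => f t * conjc (S t)) =
    cint leb (setT : set (@lebesgueType R)) (fun t => f t * conjc (r t)).
  rewrite -[cintegral _ _]/(cint leb (setT : set (@lebesgueType R))
    (fun t => f t * conjc (g t))).
  rewrite -(cintB mT (int_conj g mg' gper goo) (int_conj S mS Sper lS.2)).
  by apply: eq_cint => t _; rewrite -mulrBr /r rmorphB.
set I := cint _ _ _.
(* The 2 comes from [norm1_cint], [M] from the amalgam bound, and [delta] from the remainder of [g]
   being at most as large as [g - p]. *)
have bound : ((normc I)%:E <= (2 * (M * delta))%:E)%E.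
  apply: le_trans (norm1_cint leb mT (cmeasM mf' (cmeas_conj mr))) _.
  rewrite (EFinM 2); apply: lee_wpmul2l => //.
  apply: le_trans (norm1_le_amalgam mf' (cmeas_conj mr) _) _.
    by move=> x; rewrite rper.
  rewrite ME sqnorm_conj EFinM; apply: lee_wpmul2l => //.
  have := fourier_partial_best_approx lg tp HA0 uB sA0B => /le_trans/(_ gp) rd.
  have -> : delta%:E = ((delta ^+ 2)%:E `^ 2^-1)%E.
    by rewrite poweR_EFin -powR_mulrn ?ltW// -powRrM mulfV// powRr1 ?ltW.
  apply: gt0_ler_poweR => //.
  - by rewrite in_itv/= sqnorm_ge0 leey.
  - by rewrite in_itv/= lee_fin sqr_ge0 leey.
suff Ie : normc I < e.
  rewrite (_ : eps = e%:C); last by apply: eq_ReIm => //=; rewrite epsI.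
  by change ((normc I)%:C < e%:C); rewrite ltcR.
move: bound; rewrite lee_fin => /le_lt_trans; apply.
rewrite /delta mulrA mulrA [_ * e]mulrC -mulrA gtr_pMr//.
by rewrite ltr_pdivrMr// mul1r ltrDl.
Qed.
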